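(* Let $\{\mathcal X^\varepsilon\}$ be a $C^m$-Markov perturbation ($m\ge1$) of a synchronized DRN $\mathcal X^0$, and assume $\mu(\Omega_{\rm deg})<1$. Then there exist $0<a<1$ and $\ell\in\{1,\dots,m\}$ such that for every sufficiently small $\delta>0$ there exist $\varepsilon_\delta>0$, $b_\delta>0$, $c_\delta>0$ and maps $E_\delta,F_\delta:\Omega\to2^{\mathbb N}$ such that for $\mu$-a.e. $\omega\in\Omega$: (i) $E_\delta(\omega)\cap F_\delta(\omega)=\varnothing$, and $\liminf_{n\to\infty}\frac{\#(E_\delta(\omega)\cap\{1,\dots,n\})}{n}>a-\delta$, $\liminf_{n\to\infty}\frac{\#(F_\delta(\omega)\cap\{1,\dots,n\})}{n}>1-a-\delta$; (ii) for every $0\le\varepsilon<\varepsilon_\delta$ and any two independent copies $\mathcal X,\mathcal Y$ of $\mathcal X^\varepsilon$ started in the fibre $S\times\{\omega\}$, $\mathbb P\{X_n=Y_n\mid X_0,Y_0\in S\times\{\omega\}\}\ge1-\varepsilon^\ell b_\delta$ for all $n\in E_\delta(\omega)$, and $\mathbb P\{X_n\ne Y_n\mid X_0,Y_0\in S\times\{\omega\}\}\ge\varepsilon^\ell c_\delta$ for all $n\in F_\delta(\omega)$.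
   Context: Let $k\ge2$, $S=\{s_1,\dots,s_k\}$, $\mathbb K=\{1,\dots,k\}$, $e_1,\dots,e_k$ the canonical basis of $\mathbb R^k$; $|\cdot|$ is the $\ell^1$-norm and induced matrix norm; $\Sigma_0=\{v\in\mathbb R^k:\sum_jv_j=0\}$, $\Sigma_1^+=\{v\in\mathbb R^k:v_j\ge0,\sum_jv_j=1\}$. $\Theta=(\Omega,\mathcal F,\mu,\theta)$ is an invertible metric dynamical system (standard probability space, $\theta$ invertible, ergodic, $\mu$-preserving). A Markov random network (MRN) over $\Theta$ is a process $\mathcal X=(X_n)_{n\in\mathbb N_0}$ on $S\times\Omega$ satisfying: (MRN1) $\omega\mapsto\mathbb P\{X_n=(s_i,\theta^n\omega)\mid X_0=(s_j,\omega)\}$ is measurable; (MRN2) $\sum_i\mathbb P\{X_n=(s_i,\theta^{n-m}\omega)\mid X_m=(s_j,\omega)\}=1$ for $n\ge m$, $\mu$-a.e. $\omega$; (MRN3) the Markov property along fibres. Its transition cocycle $P_{\mathcal X}(n,\omega)=(\mathbb P\{X_n=(s_i,\theta^n\omega)\mid X_0=(s_j,\omega)\})_{i,j}$ is column-stochastic, $P_{\mathcal X}(0,\omega)=I_k$, $P_{\mathcal X}(m+n,\omega)=P_{\mathcal X}(m,\theta^n\omega)P_{\mathcal X}(n,\omega)$ for $\mu$-a.e. $\omega$. A DRN is an MRN $\mathcal X^0$ whose cocycle $P^0$ has entries in $\{0,1\}$; with $T(n,\omega)(s_j)=s_i$ iff $P^0(n,\omega)_{i,j}=1$, $\mathcal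 X^0$ is synchronized if there is a measurable $N:\Omega\to\mathbb N$ with $T(n,\omega)(s_i)=T(n,\omega)(s_j)$ for all $i,j$, $n\ge N(\omega)$, $\mu$-a.e. $\omega$. For a synchronized DRN there are $\mathcal F$-measurable $J:\Omega\to\mathbb K$ (the synchronization index, $\mu$-a.e. unique) and $N^-:\Omega\to\mathbb N$ (a pull-back synchronization time) with $P^0(n,\omega)e_{J(\omega)}=e_{J(\theta^n\omega)}$ for all $n$, and $P^0(n,\theta^{-n}\omega)e_j=e_{J(\omega)}$ for all $j$ and $n\ge N^-(\omega)$, $\mu$-a.e. $\omega$. A Markov perturbation of $\mathcal X^0$ is a family $\{\mathcal X^\varepsilon:\varepsilon\ge0\}$ of MRNs over $\Theta$ with $\mathcal X^\varepsilon=\mathcal X^0$ at $\varepsilon=0$ and $|P_{\mathcal X^\varepsilon}(1,\omega)-P^0(1,\omega)|\le\varepsilon$ for all $\varepsilon\ge0$, $\mu$-a.e. $\omega$. It is $C^m$ if there is $\varepsilon_0>0$ such that for $\mu$-a.e. $\omega$, $\varepsilon\mapsto P_{\mathcal X^\varepsilon}(1,\omega)$ is $C^m$ on $[0,\varepsilon_0]$. Then set $P^{(\ell)}(n,\omega)=\frac{d^\ell}{d\varepsilon^\ell}P_{\mathcal X^\varepsilon}(n,\omega)\big|_{\varepsilon=0}$ for $0\le\ell\le m$. Define $q^{(0)}(\omega)=e_{J(\omega)}$ and, inductively for $1\le\ell\le m$, writing $\omega^-=\theta^{-N^-(\omega)}\omega$, $q^{(\ell)}(\omega)=\sum_{i=0}^{\ell-1}\binom{\ell}{i}P^{(\ell-i)}(N^-(\omega),\omega^-)\,q^{(i)}(\omega^-)$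 (this is $\mu$-a.e. independent of the choice of $N^-$). Let $\Omega^{(0)}=\Omega$, $\Omega^{(\ell)}=\{q^{(1)}=0\}\cap\dots\cap\{q^{(\ell)}=0\}$ for $1\le\ell\le m$, and $\Omega_{\rm deg}=\Omega^{(m)}$. Two independent copies $\mathcal X,\mathcal Y$ of $\mathcal X^\varepsilon$ started in the fibre $S\times\{\omega\}$ are independent processes with cocycle $P_{\mathcal X^\varepsilon}$ and arbitrary initial distributions $u,v\in\Sigma_1^+$ on $S\times\{\omega\}$; thus $\mathbb P\{X_n=Y_n\mid X_0,Y_0\in S\times\{\omega\}\}=\sum_i(P_{\mathcal X^\varepsilon}(n,\omega)u)_i(P_{\mathcal X^\varepsilon}(n,\omega)v)_i$ and $\mathbb P\{X_n\ne Y_n\mid\cdot\}$ is one minus this. *)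

(* Defs.v *)
From HB Require Import structures.
From mathcomp Require Import all_boot all_order all_algebra.
From mathcomp Require Import all_classical all_reals all_analysis.
Set Implicit Arguments. Unset Strict Implicit. Unset Printing Implicit Defensive.
Import Order.TTheory GRing.Theory Num.Theory.
Import numFieldNormedType.Exports.
Local Open Scope classical_set_scope.
Local Open Scope ring_scope.

Section Defs.
Context (R : realType) (d : measure_display) (Omega : measurableType d)
  (mu : probability Omega R).

(* induced matrix norm of the l^1 norm: maximal absolute column sum *)
Definition mnorm1 k (A : 'M[R]_k) : R :=
  \big[Num.max/0]_(j < k) \sum_(i < k) `|A i j|.

Definition col_stochastic k (A : 'M[R]_k) : Prop :=
  (forall i j, 0 <= A i j) /\ (forall j, \sum_(i < k) A i j = 1).

Definition prob_vector k (u : 'cV[R]_k) : Prop :=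
  (forall i, 0 <= u i ord0) /\ \sum_(i < k) u i ord0 = 1.

Definition e_vec k (j : 'I_k) : 'cV[R]_k := delta_mx j ord0.

Definition invertible_mds (theta thetainv : Omega -> Omega) : Prop :=
  [/\ cancel theta thetainv /\ cancel thetainv theta,
      measurable_fun setT theta, measurable_fun setT thetainv,
      (forall A, measurable A -> mu (theta @^-1` A) = mu A) &
      (forall A, measurable A -> theta @^-1` A = A ->
         mu A = 0%E \/ mu A = 1%E)].

Fixpoint cocycle k (theta : Omega -> Omega) (A : Omega -> 'M[R]_k) (n : nat)
    (w : Omega) : 'M[R]_k :=
  match n with
  | 0 => 1%:M
  | n'.+1 => A (iter n' theta w) *m cocycle theta A n' w
  end.

(* A : Omega -> 'M_k is the one-step transition matrix P_X(1, .) of an MRN: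
   measurable (MRN1) and column-stochastic a.e. (MRN2) *)
Definition MRN_gen k (A : Omega -> 'M[R]_k) : Prop :=
  (forall i j, measurable_fun setT (fun w => A w i j)) /\
  {ae mu, forall w, col_stochastic (A w)}.

Definition is_DRN k (theta : Omega -> Omega) (A0 : Omega -> 'M[R]_k) : Prop :=
  MRN_gen A0 /\
  {ae mu, forall w, forall n i j,
     cocycle theta A0 n w i j = 0 \/ cocycle theta A0 n w i j = 1}.

Definition drn_map k (theta : Omega -> Omega) (A0 : Omega -> 'M[R]_k)
    (n : nat) (w : Omega) (j : 'I_k) : 'I_k :=
  odflt j [pick i | cocycle theta A0 n w i j == 1].

Definition synchronized k (theta : Omega -> Omega) (A0 : Omega -> 'M[R]_k)
  : Prop :=
  exists N : Omega -> nat,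
    (forall n, measurable (N @^-1` [set n])) /\
    {ae mu, forall w, forall n, (N w <= n)%N ->
       forall i j, drn_map theta A0 n w i = drn_map theta A0 n w j}.

Definition sync_index_time k (theta thetainv : Omega -> Omega)
    (A0 : Omega -> 'M[R]_k) (J : Omega -> 'I_k) (Nm : Omega -> nat) : Prop :=
  [/\ (forall j, measurable (J @^-1` [set j])),
      (forall n, measurable (Nm @^-1` [set n])) &
      {ae mu, forall w,
        (forall n, cocycle theta A0 n w *m e_vec (J w) =
                   e_vec (J (iter n theta w))) /\
        (forall n j, (Nm w <= n)%N ->
           cocycle theta A0 n (iter n thetainv w) *m e_vec j = e_vec (J w))}].

Definition markov_perturbation k (A : R -> Omega -> 'M[R]_k) : Prop :=
  (forall eps, 0 <= eps -> MRN_gen (A eps)) /\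
  (forall eps, 0 <= eps -> {ae mu, forall w, mnorm1 (A eps w - A 0 w) <= eps}).

Definition deriv_on (e : R) (f g : R -> R) : Prop :=
  forall x, 0 <= x <= e ->
    (fun y => (f y - f x) / (y - x))
      @ within [set y | 0 <= y <= e /\ y != x] (nbhs x) --> g x.

Definition Cm_on (e : R) (m : nat) (f : R -> R) : Prop :=
  exists Ds : nat -> R -> R,
    [/\ (forall x, 0 <= x <= e -> Ds 0%N x = f x),
        (forall l, (l < m)%N -> deriv_on e (Ds l) (Ds l.+1)) &
        {within [set x | 0 <= x <= e], continuous (Ds m)}].

Definition rderiv0 (f : R -> R) (l : nat) (v : R) : Prop :=
  exists e, 0 < e /\ exists Ds : nat -> R -> R,
    [/\ (forall x, 0 <= x <= e -> Ds 0%N x = f x),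
        (forall i, (i < l)%N -> deriv_on e (Ds i) (Ds i.+1)) &
        Ds l 0 = v].

Definition Cm_perturbation k (A : R -> Omega -> 'M[R]_k) (m : nat) : Prop :=
  exists e0, 0 < e0 /\
    {ae mu, forall w, forall i j, Cm_on e0 m (fun eps => A eps w i j)}.

Definition cocycle_derivs k (theta : Omega -> Omega)
    (A : R -> Omega -> 'M[R]_k) (m : nat)
    (Pd : nat -> nat -> Omega -> 'M[R]_k) : Prop :=
  (forall l n i j, measurable_fun setT (fun w => Pd l n w i j)) /\
  {ae mu, forall w, forall l n i j, (l <= m)%N ->
     rderiv0 (fun eps => cocycle theta (A eps) n w i j) l (Pd l n w i j)}.

(* q_upto l i w = q^(i)(w) for i <= l *)
Fixpoint q_upto k (thetainv : Omega -> Omega) (J : Omega -> 'I_k)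
    (Nm : Omega -> nat) (Pd : nat -> nat -> Omega -> 'M[R]_k) (l : nat)
    : nat -> Omega -> 'cV[R]_k :=
  match l with
  | 0 => fun _ w => e_vec (J w)
  | l'.+1 =>
      let g := q_upto thetainv J Nm Pd l' in
      fun i w =>
        if (i <= l')%N then g i w else
        let wm := iter (Nm w) thetainv w in
        \sum_(i0 < l'.+1)
           ((Pd (l'.+1 - i0)%N (Nm w) wm *m g i0 wm) *+ 'C(l'.+1, i0))
  end.

Definition qvec k (thetainv : Omega -> Omega) (J : Omega -> 'I_k)
    (Nm : Omega -> nat) (Pd : nat -> nat -> Omega -> 'M[R]_k) (l : nat)
    (w : Omega) : 'cV[R]_k :=
  q_upto thetainv J Nm Pd l l w.

Definition Omega_deg k (thetainv : Omega -> Omega) (J : Omega -> 'I_k)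
    (Nm : Omega -> nat) (Pd : nat -> nat -> Omega -> 'M[R]_k) (m : nat)
    : set Omega :=
  [set w | forall l, (1 <= l <= m)%N -> qvec thetainv J Nm Pd l w = 0].

(* P{X_n = Y_n} for independent copies with initial laws u, v and
   n-step transition matrix P *)
Definition meet_prob k (P : 'M[R]_k) (u v : 'cV[R]_k) : R :=
  \sum_(i < k) (P *m u) i ord0 * (P *m v) i ord0.

Definition dens (E : set nat) (n : nat) : R :=
  (\sum_(1 <= i < n.+1) (\1_E i : R)) / n%:R.

End Defs.
Arguments dens {R} E n.

(* Main.v *)
Require Import Defs.
From HB Require Import structures.
From mathcomp Require Import all_boot all_order all_algebra.
From mathcomp Require Import all_classical all_reals all_analysis.
From mathcomp Require Import measurable_realfun lra.
Import Order.TTheory GRing.Theory Num.Theory.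
Import numFieldNormedType.Exports.
Local Open Scope classical_set_scope.
Local Open Scope ring_scope.
Set Implicit Arguments. Unset Strict Implicit. Unset Printing Implicit Defensive.

(**
Write [P_eps(n,w)] for the cocycle and [w_n = theta^-n w].  Once [P_0] has
synchronized it kills sum-zero vectors, so [P_eps(n,w_n)] multiplies a sum-zero
vector by [O(eps)] when [n >= Nm w].  After enough synchronizing blocks the
initial law is therefore forgotten up to [O(eps^(l+1))].  Let [l] be the first
order at which [q^(l)] is not almost everywhere zero.  By induction on [i <= l],
[P_eps(n,w) e_J(w) = e_J(theta^n w) + O(eps^i)], and Taylor's formula gives, for
some [K] depending on [w] and every [j],
[P_eps(K,w_K) e_j = e_J(w) + q^(l)(w) eps^l / l! + o(eps^l)].
Since [q^(l)(w)] has sum zero and is nonnegative off the index [J w], the mass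
missing at [J w] is [O(eps^l)], and of exact order [eps^l] when [q^(l)(w) <> 0].
These constants are uniform on sets of measure close to 1, and the pointwise
ergodic theorem (lower bound for indicators, proved by the covering argument of
Katznelson and Weiss) turns measures into frequencies of times.
*)

(** * Asymptotics at 0+ and Taylor expansion *)

(** The obstacle is uniformity in [n]: comparing [P_eps(n,w)] with [P_0(n,w)] step by step gives
    [O(eps)] with a constant depending on [n]. Looking back from the fibre reached at time [n]
    removes it. A window of [K] steps ending there, with [K] depending only on that fibre, already
    determines the law to the required order, and everything earlier enters as an arbitrary
    probability vector at time [n - K]. So the constants are functions of the target fibre, and only
    finitely many steps are ever expanded. The choice of [l] also makes the recursion for [q^(l)]
    collapse: as the lower corrections vanish along almost every orbit, a single term remains, the
    [l]-th derivative of one column of a pull-back matrix. With [X] the event [q^(l) <> 0], the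
    lower bound on separation is available at visits to [X], whereas the lower bound on meeting
    holds at all times with good constants. This gives [a = 1 - mu(X)]; if [mu(X) = 1] this would be
    0, and half of the times are given to [E], so [a = 1/2]. *)

Section Asymptotics.
Context {R : realType}.
Implicit Types (f g h : R -> R) (i j l n : nat).

(** Orders are taken on the right of 0, as the family is given for nonnegative parameters. Constants
    may depend on everything but [x]. *)
Definition isbigO i g : Prop :=
  exists C, \forall x \near (0:R)^'+, `|g x| <= C * x ^+ i.

Definition islittleo i g : Prop :=
  forall eta, 0 < eta -> \forall x \near (0:R)^'+, `|g x| <= eta * x ^+ i.

Lemma isbigO_ext i f g : (\forall x \near (0:R)^'+, f x = g x) ->
  isbigO i f -> isbigO i g.
Proof.
move=> fg [C HC]; exists C; near=> x.
have <- : f x = g x by near: x.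
by near: x.
Unshelve. all: by end_near. Qed.

Lemma isbigO_cst0 i : isbigO i (fun=> 0).
Proof. by exists 0; near=> x; rewrite normr0 mul0r. Unshelve. all: by end_near. Qed.

Lemma isbigOD i f g : isbigO i f -> isbigO i g -> isbigO i (fun x => f x + g x).
Proof.
move=> [C HC] [D HD]; exists (C + D); near=> x.
rewrite mulrDl (le_trans (ler_normD _ _))// lerD//; by near: x.
Unshelve. all: by end_near. Qed.

Lemma isbigO_sum i (I : Type) (s : seq I) (F : I -> R -> R) :
  (forall a, isbigO i (F a)) -> isbigO i (fun x => \sum_(a <- s) F a x).
Proof.
move=> HF; elim: s => [|a s IH].
  by apply: (@isbigO_ext _ (fun=> 0)) (isbigO_cst0 i); near=> x; rewrite big_nil.
by apply: isbigO_ext (isbigOD (HF a) IH); near=> x; rewrite big_cons.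
Unshelve. all: by end_near. Qed.

Lemma isbigOM i j f g : isbigO i f -> isbigO j g -> isbigO (i + j)%N (fun x => f x * g x).
Proof.
move=> [C HC] [D HD]; exists (C * D); near=> x.
rewrite normrM exprD mulrACA ler_pM//; by near: x.
Unshelve. all: by end_near. Qed.

Lemma islittleoD i f g : islittleo i f -> islittleo i g -> islittleo i (fun x => f x + g x).
Proof.
move=> Hf Hg e e0; have e2 : 0 < e / 2 by rewrite divr_gt0.
near=> x.
rewrite (splitr e) mulrDl (le_trans (ler_normD _ _))// lerD//; near: x;
  [exact: Hf|exact: Hg].
Unshelve. all: by end_near. Qed.

Lemma islittleoN i f : islittleo i f -> islittleo i (fun x => - f x).
Proof. by move=> Hf e e0; near=> x; rewrite normrN; near: x; exact: Hf.
Unshelve. all: by end_near. Qed.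

Lemma islittleo_ext i f g : (\forall x \near (0:R)^'+, f x = g x) ->
  islittleo i f -> islittleo i g.
Proof.
move=> fg Hf e e0; near=> x.
have <- : f x = g x by near: x.
by near: x; exact: Hf.
Unshelve. all: by end_near. Qed.

Lemma islittleo_cst0 i : islittleo i (fun=> 0).
Proof.
by move=> e e0; near=> x; rewrite normr0 mulr_ge0// ?exprn_ge0// ltW.
Unshelve. all: by end_near. Qed.

Lemma islittleo_sum i (I : Type) (s : seq I) (F : I -> R -> R) :
  (forall a, islittleo i (F a)) -> islittleo i (fun x => \sum_(a <- s) F a x).
Proof.
move=> HF; elim: s => [|a s IH].
  by apply: (@islittleo_ext _ (fun=> 0)) (islittleo_cst0 i); near=> x; rewrite big_nil.
by apply: islittleo_ext (islittleoD (HF a) IH); near=> x; rewrite big_cons.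
Unshelve. all: by end_near. Qed.

Lemma isbigOS_islittleo i f : isbigO i.+1 f -> islittleo i f.
Proof.
move=> [C HC] e e0; pose D := `|C| + 1.
have D0 : 0 < D by rewrite ltr_wpDl.
near=> x.
have x0 : 0 < x by [].
have xe : x < e / D by near: x; apply: nbhs_right_lt; rewrite divr_gt0.
have : `|f x| <= C * x ^+ i.+1 by near: x.
move=> /le_trans; apply.
rewrite exprS mulrA ler_wpM2r// ?exprn_ge0 ?ltW//.
rewrite (@le_lt_trans _ _ (D * x))//; last by rewrite mulrC -ltr_pdivlMr.
rewrite ler_wpM2r// ?ltW// /D.
by have := ler_norm C; lra.
Unshelve. all: by end_near. Qed.

Lemma islittleo_isbigO i f : islittleo i f -> isbigO i f.
Proof. by move=> Hf; exists 1; exact: Hf. Qed.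

Lemma isbigO_monomial (c : R) i : isbigO i (fun x => c * x ^+ i).
Proof.
exists `|c|; near=> x; rewrite normrM ler_wpM2l// ger0_norm// exprn_ge0//.
Unshelve. all: by end_near. Qed.

(** A negative [c] would outweigh a remainder of size [|c| x^i / 2]. Applied to [f = 0] with both
    signs, it shows that a coefficient vanishes. *)
Lemma expansion_ge0 (c : R) i f : (\forall x \near (0:R)^'+, 0 <= f x) ->
  islittleo i (fun x => f x - c * x ^+ i) -> 0 <= c.
Proof.
move=> f0 Hf; rewrite leNgt; apply/negP => c0.
have c2 : 0 < - c / 2 by rewrite divr_gt0// oppr_gt0.
near (0:R)^'+ => x.
have x0 : 0 < x by [].
have xi : 0 < x ^+ i by rewrite exprn_gt0.
have fx : 0 <= f x by near: x.
have : `|f x - c * x ^+ i| <= - c / 2 * x ^+ i by near: x; exact: Hf.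
rewrite ler_norml => /andP[_ H].
have : (c / 2) * x ^+ i < 0 by rewrite nmulr_rlt0// ?pmulr_llt0 ?invr_gt0.
move: H; rewrite mulrAC (mulrAC c) mulNr; lra.
Unshelve. all: by end_near. Qed.

Lemma islittleo0_horner (p : {poly R}) : islittleo 0 (horner p) -> p`_0 = 0.
Proof.
move=> Hp; apply/eqP; rewrite -horner_coef0 -normr_eq0 eq_le normr_ge0 andbT.
rewrite leNgt; apply/negP => c0; set c := `|p.[0]| in c0 *.
have cv : p.[x] @[x --> (0:R)^'+] --> p.[0].
  exact/cvg_at_right_filter/continuous_horner.
near (0:R)^'+ => x.
have h1 : `|p.[x]| <= c / 2 * x ^+ 0 by near: x; apply: Hp; rewrite divr_gt0.
have h2 : `|p.[0] - p.[x]| < c / 2.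
  by near: x; move/cvgrPdist_lt: cv; apply; rewrite divr_gt0.
have : c <= `|p.[0] - p.[x]| + `|p.[x]|.
  by rewrite -[leLHS]/(`|p.[0]|) -{1}(subrK p.[x] p.[0]) ler_normD.
by move: h1 h2; rewrite expr0 mulr1; lra.
Unshelve. all: by end_near. Qed.

(** The constant term is a limit at 0; once it is gone, dividing by ['X] lowers the order by one. *)
Lemma islittleo_horner_coef0 n (p : {poly R}) : islittleo n (horner p) ->
  forall i, (i <= n)%N -> p`_i = 0.
Proof.
elim: n p => [|n IH] p Hp.
  by move=> i; rewrite leqn0 => /eqP ->; exact: islittleo0_horner.
have p0 : p`_0 = 0.
  apply: islittleo0_horner => e e0; near=> x.
  apply: (@le_trans _ _ (e * x ^+ n.+1)); first by near: x; exact: Hp.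
  rewrite expr0 ler_wpM2l// ?(ltW e0)// exprn_ile1//.
  by near: x; apply: nbhs_right_le; exact: ltr01.
have [q pE] : exists q, p = q * 'X.
  exists (p %/ 'X)%R; rewrite divpK// -['X]subr0 dvdp_XsubCl.
  by rewrite rootE horner_coef0 p0.
have Hq : islittleo n (horner q).
  move=> e e0; near=> x.
  have x0 : 0 < x by [].
  have : `|p.[x]| <= e * x ^+ n.+1 by near: x; exact: Hp.
  by rewrite pE hornerMX normrM (gtr0_norm x0) exprSr mulrA ler_pM2r.
by case=> [//|i] ilen; rewrite pE coefMX /=; exact: IH.
Unshelve. all: by end_near. Qed.

Lemma primitive_poly (p : {poly R}) : exists q : {poly R},
  [/\ q^`() = p, (size q <= (size p).+1)%N, q`_0 = 0 &
      forall i, q`_i.+1 = p`_i / i.+1%:R].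
Proof.
exists (\poly_(i < (size p).+1) (if i is i'.+1 then p`_i' / i%:R else 0)).
have coefE i : (\poly_(i < (size p).+1)
    (if i is i'.+1 then p`_i' / i%:R else 0))`_i.+1 = p`_i / i.+1%:R.
  rewrite coef_poly ltnS; case: ltnP => // h.
  by rewrite nth_default// mul0r.
split=> //; last by rewrite coef_poly.
apply/polyP => i; rewrite coef_deriv coefE -(mulr_natr (_ / _)) divfK//.
Qed.

(** At interior points the quotient restricted to the interval is a two-sided one, as the mean value
    theorem wants. *)
Lemma deriv_on_is_derive e f g x : deriv_on e f g -> 0 < x < e ->
  is_derive x 1 f (g x).
Proof.
move=> fg /andP[x0 xe].
have /fg xcv : 0 <= x <= e by rewrite !ltW.
have cv : h^-1 *: (f (h *: 1 + x) - f x) @[h --> (0:R)^'] --> g x.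
  apply/cvgrPdist_lt => eta eta0; move/cvgrPdist_lt: xcv => /(_ _ eta0).
  rewrite near_withinE => /nbhs_ballP[r /= r0 Hr].
  have m0 : 0 < Num.min r (Num.min x (e - x)) by rewrite !lt_min r0 x0 subr_gt0.
  rewrite near_withinE; apply/nbhs_ballP; eexists; first exact: m0.
  move=> h; rewrite /ball/= sub0r normrN !lt_min => /and3P[hb hx hex] h0.
  have := Hr (h + x).
  rewrite /ball/= opprD addrCA subrr addr0 normrN => /(_ hb).
  rewrite addrK mulrC /= [h *: 1]mulr1; apply; split.
    move: hx hex; rewrite !ltr_norml => /andP[? ?] /andP[? ?].
    by apply/andP; split; lra.
  by rewrite -subr_eq0 addrK.
apply: DeriveDef; first by apply/cvg_ex; exists (g x).
exact: cvg_lim cv.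
Qed.

Lemma deriv_on_right_quot e f g x : deriv_on e f g -> 0 <= x < e ->
  (f y - f x) / (y - x) @[y --> x^'+] --> g x.
Proof.
move=> fg /andP[x0 xe].
have /fg xcv : 0 <= x <= e by rewrite x0 ltW.
apply/cvgrPdist_lt => eta eta0; move/cvgrPdist_lt: xcv => /(_ _ eta0).
rewrite near_withinE => H; near=> y.
have xy : x < y by [].
have : ([set y : R | 0 <= y <= e /\ y != x] y ->
        `|g x - (f y - f x) / (y - x)| < eta).
  by near: y; rewrite near_withinE; apply: filterS H => z Hz _; exact: Hz.
apply; split; last by rewrite gt_eqF.
by rewrite (le_trans x0 (ltW xy))/= ltW//; near: y; exact: nbhs_right_lt.
Unshelve. all: by end_near. Qed.

Lemma deriv_on_right_cts e f g x : deriv_on e f g -> 0 <= x < e ->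
  f y @[y --> x^'+] --> f x.
Proof.
move=> fg xe; have cv := deriv_on_right_quot fg xe.
have : f x + (f y - f x) / (y - x) * (y - x) @[y --> x^'+] --> f x + g x * (x - x).
  apply: cvgD; first exact: cvg_cst.
  apply: cvgM => //; apply: cvgB; last exact: cvg_cst.
  exact/cvg_at_right_filter/cvg_id.
rewrite subrr mulr0 addr0; apply: cvg_trans.
apply: near_eq_cvg; near=> y.
by rewrite divfK ?subr_eq0 ?gt_eqF// addrC subrK.
Unshelve. all: by end_near. Qed.

(** Induction by integrating the expansion of the derivative: the difference between [Ds 0] and the
    primitive polynomial has a derivative that is already small, and the mean value theorem adds one
    power of [x]. The remainder is of Peano type because [rderiv0] gives no continuity of the last
    derivative. *)
Lemma peano_expansion l e (Ds : nat -> R -> R) : 0 < e ->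
  (forall i, (i < l.+1)%N -> deriv_on e (Ds i) (Ds i.+1)) ->
  exists p : {poly R}, [/\ (size p <= l.+2)%N,
    p`_l.+1 = Ds l.+1 0 / (l.+1)`!%:R & islittleo l.+1 (fun x => Ds 0%N x - p.[x])].
Proof.
move=> e0; elim: l Ds => [|l IH] Ds HDs.
  exists ((Ds 1%N 0) *: 'X + (Ds 0%N 0)%:P); split.
  - rewrite -mul_polyC size_MXaddC; case: ifP => // _.
    by rewrite ltnS size_polyC; case: (_ != _).
  - by rewrite coefD coefZ coefX coefC /= mulr1 addr0 divr1.
  - have := deriv_on_right_quot (HDs 0%N isT) (x := 0).
    rewrite lexx e0 => /(_ isT)/cvgrPdist_le cv eta eta0.
    near=> x.
    have x0 : 0 < x by [].
    have : `|Ds 1%N 0 - (Ds 0%N x - Ds 0%N 0) / (x - 0)| <= eta.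
      by near: x; exact: cv.
    rewrite subr0 !hornerE expr1 => H.
    rewrite (_ : _ - _ = - ((Ds 1%N 0 - (Ds 0%N x - Ds 0%N 0) / x) * x)).
      by rewrite normrN normrM (gtr0_norm x0) ler_pM2r.
    by rewrite mulrBl divfK ?gt_eqF//; lra.
have [p [sp pl Hp]] := IH (fun i => Ds i.+1) (fun i il => HDs i.+1 il).
have [q [q' sq q0 qE]] := primitive_poly p.
exists (q + (Ds 0%N 0)%:P); split.
- rewrite (leq_trans (size_polyD _ _))// geq_max (leq_trans sq)//=.
  by rewrite size_polyC; case: (_ != _).
- by rewrite coefD coefC /= addr0 qE pl -mulrA -invfM -natrM mulnC -factS.
move=> eta eta0; near=> x.
have x0 : 0 < x by [].
have xe : x < e by near: x; exact: nbhs_right_lt.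
pose h y := Ds 0%N y - (q + (Ds 0%N 0)%:P).[y].
have dh y : 0 < y < e -> is_derive y 1 h (Ds 1%N y - p.[y]).
  move=> ye; apply: is_deriveB.
    exact: (deriv_on_is_derive (HDs 0%N isT)).
  apply: DeriveDef; first exact: derivable_horner.
  by rewrite -derive1E -derivE derivD derivC addr0 q'.
have [c cx] : exists2 c, c \in `]0, x[%R &
    h x - h 0 = (Ds 1%N c - p.[c]) * (x - 0).
  apply: (MVT x0).
    by move=> y; rewrite in_itv/= => /andP[y0 yx]; apply: dh; rewrite y0 (lt_trans yx).
  apply/(continuous_within_itvP _ x0); split.
  - move=> y; rewrite in_itv/= => /andP[y0 yx].
    apply/differentiable_continuous/derivable1_diffP.
    by apply: ex_derive; apply: dh; rewrite y0 (lt_trans yx).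
  - apply: cvgB; first by apply: (deriv_on_right_cts (HDs 0%N isT)); rewrite lexx.
    exact/cvg_at_right_filter/continuous_horner.
  - apply: cvg_at_left_filter.
    apply/differentiable_continuous/derivable1_diffP.
    by apply: ex_derive; apply: dh; rewrite x0.
have -> : h 0 = 0 by rewrite /h !hornerE horner_coef0 q0 add0r subrr.
rewrite !subr0 -[leLHS]/(`|h x|) => ->.
rewrite normrM (gtr0_norm x0) exprSr mulrA ler_pM2r//.
move: cx; rewrite in_itv/= => /andP[c0 cx].
apply: (@le_trans _ _ (eta * c ^+ l.+1)); last first.
  by rewrite ler_wpM2l ?(ltW eta0)// lerXn2r// ?nnegrE ltW.
(* The point [c] varies with [x], so the bound on the derivative is asked for all of []0, x[] at
   once; a ball around 0 provides it. *)
move: c c0 cx; near: x.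
have := Hp _ eta0; rewrite !near_withinE => /nbhs_ballP[r /= r0 Hr].
apply/nbhs_ballP; exists r => //= y; rewrite /ball/= sub0r normrN => yr y0 c c0 cy.
apply: Hr => //; rewrite /ball/= sub0r normrN gtr0_norm//.
by rewrite (lt_trans cy)// -(gtr0_norm y0).
Unshelve. all: by end_near. Qed.

(* A function that is [o(x^(l-1))] up to a constant has no lower-order Taylor
   terms, so only the [l]-th derivative survives. *)
Lemma leading_expansion l f c v : rderiv0 f l.+1 v ->
  islittleo l (fun x => f x - c) ->
  islittleo l.+1 (fun x => f x - c - v / (l.+1)`!%:R * x ^+ l.+1).
Proof.
move=> [e [e0 [Ds [Df HDs Dv]]]] Hf.
have [p [sp pl Hp]] := peano_expansion e0 HDs.
have Df' : \forall x \near (0:R)^'+, Ds 0%N x = f x.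
  near=> x; apply: Df; apply/andP; split; first exact: ltW.
  by near: x; exact: nbhs_right_le.
have Hp' : islittleo l.+1 (fun x => f x - p.[x]).
  by apply: islittleo_ext Hp; apply: filterS Df' => x ->.
pose q := p - c%:P.
have Hq : islittleo l (horner q).
  have := islittleoD Hf (islittleoN (isbigOS_islittleo (islittleo_isbigO Hp'))).
  by apply: islittleo_ext; near=> x; rewrite /q !hornerE; lra.
have qE : q = (v / (l.+1)`!%:R) *: 'X^(l.+1).
  apply/polyP => i; rewrite coefZ coefXn.
  case: (ltngtP i l.+1) => il.
  - by rewrite mulr0; apply: islittleo_horner_coef0 Hq _ _.
  - rewrite mulr0 nth_default// (leq_trans _ il)//.
    rewrite (leq_trans (size_polyD _ _))// geq_max sp size_polyN size_polyC.
    by case: (_ != _).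
  - by rewrite il coefB coefC pl Dv subr0 mulr1.
apply: islittleo_ext Hp'; near=> x.
by rewrite -[p](subrK c%:P) -/q qE !hornerE opprD addrA addrAC.
Unshelve. all: by end_near. Qed.

End Asymptotics.

(** * Pull-back expansion along an orbit *)

Section StochasticMatrices.
Context {R : realType}.

Lemma mulmx_e_vec p k (M : 'M[R]_(p, k)) j a : (M *m e_vec R j) a ord0 = M a j.
Proof. by rewrite /e_vec -colE mxE. Qed.

Lemma subcvE k (u v : 'cV[R]_k) a : (u - v) a ord0 = u a ord0 - v a ord0.
Proof. by rewrite !mxE. Qed.

Lemma col_stochastic_mul k (M N : 'M[R]_k) :
  col_stochastic M -> col_stochastic N -> col_stochastic (M *m N).
Proof.
move=> [M0 M1] [N0 N1]; split=> [i j|j].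
  by rewrite mxE sumr_ge0// => a _; rewrite mulr_ge0.
under eq_bigr do rewrite mxE.
rewrite exchange_big/=; under eq_bigr do rewrite -mulr_suml M1 mul1r.
exact: N1.
Qed.

Lemma col_stochastic1 k : col_stochastic (1%:M : 'M[R]_k).
Proof.
split=> [i j|j]; first by rewrite mxE ler0n.
rewrite (bigD1 j)//= mxE eqxx big1 ?addr0// => i ij.
by rewrite mxE (negbTE ij).
Qed.

Lemma col_stochastic_le1 k (M : 'M[R]_k) i j : col_stochastic M -> M i j <= 1.
Proof.
move=> [M0 M1]; rewrite -(M1 j) (bigD1 i)//= lerDl sumr_ge0//.
Qed.

Lemma prob_vector_mul k (M : 'M[R]_k) u :
  col_stochastic M -> prob_vector u -> prob_vector (M *m u).
Proof.
move=> [M0 M1] [u0 u1]; split=> [i|].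
  by rewrite mxE sumr_ge0// => a _; rewrite mulr_ge0.
under eq_bigr do rewrite mxE.
rewrite exchange_big/=; under eq_bigr do rewrite -mulr_suml M1 mul1r.
exact: u1.
Qed.

Lemma le_mnorm1 k (M : 'M[R]_k) i j : `|M i j| <= mnorm1 M.
Proof.
apply: (@le_trans _ _ (\sum_(a < k) `|M a j|)).
  by rewrite (bigD1 i)//= lerDl sumr_ge0.
exact: (le_bigmax _ (fun j => \sum_(a < k) `|M a j|) j).
Qed.

Definition isbigOmx p q i (M : R -> 'M[R]_(p, q)) : Prop :=
  forall a b, isbigO i (fun x => M x a b).

Lemma isbigOmx_mul p q r i j (M : R -> 'M[R]_(p, q)) (N : R -> 'M[R]_(q, r)) :
  isbigOmx i M -> isbigOmx j N -> isbigOmx (i + j) (fun x => M x *m N x).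
Proof.
move=> HM HN a b.
apply: isbigO_ext (isbigO_sum (index_enum _) (fun c => isbigOM (HM a c) (HN c b))).
by near=> x; rewrite mxE.
Unshelve. all: by end_near. Qed.

Lemma isbigOmx_ext p q i (M N : R -> 'M[R]_(p, q)) :
  (\forall x \near (0:R)^'+, M x = N x) -> isbigOmx i M -> isbigOmx i N.
Proof.
by move=> MN HM a b; apply: isbigO_ext (HM a b); apply: filterS MN => x ->.
Qed.

Lemma isbigOmxD p q i (M N : R -> 'M[R]_(p, q)) :
  isbigOmx i M -> isbigOmx i N -> isbigOmx i (fun x => M x + N x).
Proof.
move=> HM HN a b; apply: isbigO_ext (isbigOD (HM a b) (HN a b)).
by near=> x; rewrite mxE.
Unshelve. all: by end_near. Qed.

Lemma isbigOmx_cst p q (M : 'M[R]_(p, q)) : isbigOmx 0 (fun=> M).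
Proof.
by move=> a b; exists `|M a b|; near=> x; rewrite expr0 mulr1.
Unshelve. all: by end_near. Qed.

End StochasticMatrices.

Section Cocycle.
Context {R : realType} (d : measure_display) (Omega : measurableType d).
Variables (theta thetainv : Omega -> Omega).
Hypothesis thetaK : cancel theta thetainv.
Hypothesis thetainvK : cancel thetainv theta.

Lemma cocycleD k (B : Omega -> 'M[R]_k) a b w :
  cocycle theta B (a + b) w =
  cocycle theta B a (iter b theta w) *m cocycle theta B b w.
Proof.
elim: a => [|a IH] /=; first by rewrite mul1mx.
by rewrite IH mulmxA iterD.
Qed.

Lemma iter_thetainvK n w : iter n theta (iter n thetainv w) = w.
Proof. by elim: n w => //= n IH w; rewrite -iterS iterSr/= thetainvK. Qed.

Lemma iter_thetaK n w : iter n thetainv (iter n theta w) = w.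
Proof. by elim: n w => //= n IH w; rewrite -iterS iterSr/= thetaK. Qed.

Lemma cocycle_backD k (B : Omega -> 'M[R]_k) a b w :
  cocycle theta B (a + b) (iter (a + b) thetainv w) =
  cocycle theta B a (iter a thetainv w) *m
  cocycle theta B b (iter b thetainv (iter a thetainv w)).
Proof. by rewrite cocycleD (addnC a b) iterD iter_thetainvK. Qed.

End Cocycle.

Section Qvec.
Context {R : realType} (d : measure_display) (Omega : measurableType d).
Variables (thetainv : Omega -> Omega) (k : nat) (J : Omega -> 'I_k)
  (Nm : Omega -> nat) (Pd : nat -> nat -> Omega -> 'M[R]_k).

Lemma q_upto_qvec l i w : (i <= l)%N ->
  q_upto thetainv J Nm Pd l i w = qvec thetainv J Nm Pd i w.
Proof.
elim: l => [|l IH]; first by rewrite leqn0 => /eqP ->.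
rewrite leq_eqVlt => /predU1P[->//|]; rewrite ltnS => il /=.
by rewrite il IH.
Qed.

Lemma qvecS l w : let wm := iter (Nm w) thetainv w in
  qvec thetainv J Nm Pd l.+1 w =
  \sum_(i < l.+1)
    ((Pd (l.+1 - i)%N (Nm w) wm *m qvec thetainv J Nm Pd i wm) *+ 'C(l.+1, i)).
Proof.
rewrite /qvec /= ltnn; apply: eq_bigr => i _.
by rewrite q_upto_qvec// -ltnS.
Qed.

(** The recursion keeps only its term of index 0, where [q^(0)] is [e_vec R (J wm)]. *)
Lemma qvecS_vanish l w : let wm := iter (Nm w) thetainv w in
  (forall i, (1 <= i <= l)%N -> qvec thetainv J Nm Pd i wm = 0) ->
  qvec thetainv J Nm Pd l.+1 w = Pd l.+1 (Nm w) wm *m e_vec R (J wm).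
Proof.
move=> wm H; rewrite qvecS big_ord_recl/= subn0 bin0 mulr1n big1 ?addr0// => i _.
by rewrite H ?mulmx0 ?mul0rn//= /bump add1n ltn_ord.
Qed.

End Qvec.

(** * Expansions in the parameter over an orbit-invariant set of good fibres *)

Section Pointwise.
Context {R : realType} (d : measure_display) (Omega : measurableType d).
Variables (theta thetainv : Omega -> Omega) (k : nat).
Variables (A : R -> Omega -> 'M[R]_k) (J : Omega -> 'I_k) (Nm : Omega -> nat)
  (Pd : nat -> nat -> Omega -> 'M[R]_k).
Variables (m L : nat) (e0 : R) (Good : set Omega).
Hypothesis thetainvK : cancel thetainv theta.
Hypothesis thetaK : cancel theta thetainv.
Hypothesis Good_theta : forall w, Good w -> Good (theta w).
Hypothesis Good_thetainv : forall w, Good w -> Good (thetainv w).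
Hypothesis e0_gt0 : 0 < e0.
Hypothesis A_stoch : forall w, Good w -> forall x, 0 <= x < e0 ->
  col_stochastic (A x w).
Hypothesis A_near : forall w, Good w -> forall x, 0 <= x < e0 ->
  forall a b, `|A x w a b - A 0 w a b| <= x.
Hypothesis J_push : forall w, Good w -> forall n,
  cocycle theta (A 0) n w *m e_vec R (J w) = e_vec R (J (iter n theta w)).
Hypothesis J_pull : forall w, Good w -> forall n j, (Nm w <= n)%N ->
  cocycle theta (A 0) n (iter n thetainv w) *m e_vec R j = e_vec R (J w).
Hypothesis A_deriv : forall w, Good w -> forall l n i j, (l <= m)%N ->
  rderiv0 (fun x => cocycle theta (A x) n w i j) l (Pd l n w i j).
Hypothesis L_le : (1 <= L <= m)%N.
Hypothesis q_vanish : forall w, Good w -> forall i, (1 <= i < L)%N ->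
  qvec thetainv J Nm Pd i w = 0.

Local Notation P x n w := (cocycle theta (A x) n w).
Local Notation back n w := (iter n thetainv w).
Local Notation q := (qvec thetainv J Nm Pd).

Lemma Good_iter n w : Good w -> Good (iter n theta w).
Proof. by move=> Gw; elim: n => //= n; exact: Good_theta. Qed.

Lemma Good_back n w : Good w -> Good (back n w).
Proof. by move=> Gw; elim: n => //= n; exact: Good_thetainv. Qed.

Lemma P_stoch n w x : Good w -> 0 <= x < e0 -> col_stochastic (P x n w).
Proof.
move=> Gw xe; elim: n => [|n IH] /=; first exact: col_stochastic1.
by apply: col_stochastic_mul => //; apply: A_stoch => //; exact: Good_iter.
Qed.

Lemma near_range : \forall x \near (0:R)^'+, 0 <= x < e0.
Proof.
near=> x; apply/andP; split; first exact: ltW.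
by near: x; exact: nbhs_right_lt.
Unshelve. all: by end_near. Qed.

Lemma isbigOmx_stoch (M : R -> 'M[R]_k) :
  (forall x, 0 <= x < e0 -> col_stochastic (M x)) -> isbigOmx 0 M.
Proof.
move=> HM a b; exists 1; near=> x.
have [M0 _] : col_stochastic (M x) by apply: HM; near: x; exact: near_range.
rewrite expr0 mulr1 ger0_norm//; apply: col_stochastic_le1; apply: HM.
by near: x; exact: near_range.
Unshelve. all: by end_near. Qed.

Lemma isbigOmx_P n w : Good w -> isbigOmx 0 (fun x => P x n w).
Proof. by move=> Gw; apply: isbigOmx_stoch => x; exact: P_stoch. Qed.

Lemma isbigOmx_P0 n w : Good w -> isbigOmx 0 (fun=> P 0 n w).
Proof.
by move=> Gw; apply: isbigOmx_stoch => x _; apply: P_stoch => //; rewrite lexx.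
Qed.

(** Telescoping: [A_x P_x - A_0 P_0 = A_x (P_x - P_0) + (A_x - A_0) P_0], with stochastic, hence
    bounded, factors. *)
Lemma isbigOmx_Pdiff n w : Good w -> isbigOmx 1 (fun x => P x n w - P 0 n w).
Proof.
move=> Gw; elim: n => [|n IH].
  move=> a b; apply: isbigO_ext (isbigO_cst0 1).
  by near=> x; rewrite /= subrr mxE.
set w' := iter n theta w; have Gw' : Good w' by exact: Good_iter.
have HA : isbigOmx 0 (fun x => A x w') by apply: isbigOmx_stoch => x; exact: A_stoch.
have HD : isbigOmx 1 (fun x => A x w' - A 0 w').
  move=> a b; exists 1; near=> x.
  rewrite mul1r expr1 !mxE; apply: A_near => //.
  by near: x; exact: near_range.
have := isbigOmxD (isbigOmx_mul HA IH) (isbigOmx_mul HD (isbigOmx_P0 n Gw)).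
rewrite add0n; apply: isbigOmx_ext; near=> x.
by rewrite /= -/w' mulmxBr mulmxBl addrA subrK.
Unshelve. all: by end_near. Qed.

(* The unperturbed dynamics sends every sum-zero vector to 0 once it has
   synchronized, so the perturbed one gains a factor [eps]. *)
Lemma sync_gain w n i (z : R -> 'cV[R]_k) : Good w -> (Nm w <= n)%N ->
  (\forall x \near (0:R)^'+, \sum_(a < k) z x a ord0 = 0) ->
  isbigOmx i z -> isbigOmx i.+1 (fun x => P x n (back n w) *m z x).
Proof.
move=> Gw Nn z0 Hz.
have := isbigOmx_mul (isbigOmx_Pdiff n (Good_back n Gw)) Hz; rewrite add1n.
apply: isbigOmx_ext; near=> x; rewrite mulmxBl.
suff -> : P 0 n (back n w) *m z x = 0 by rewrite subr0.
apply/matrixP => a b; rewrite (ord1 b) !mxE.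
under eq_bigr => c _.
  rewrite -(mulmx_e_vec (P 0 n (back n w)) c a) (J_pull Gw c Nn); over.
rewrite -mulr_sumr; have -> : \sum_(a < k) z x a ord0 = 0 by near: x.
by rewrite mulr0.
Unshelve. all: by end_near. Qed.

Lemma sum_e_vec (j : 'I_k) : \sum_(a < k) (e_vec R j) a ord0 = 1.
Proof.
rewrite (bigD1 j)//= mxE !eqxx big1 ?addr0// => a aj.
by rewrite mxE (negbTE aj).
Qed.

Lemma sum_P_e_vec n w (j j' : 'I_k) : Good w ->
  \forall x \near (0:R)^'+,
    \sum_(a < k) (P x n w *m e_vec R j - e_vec R j') a ord0 = 0.
Proof.
move=> Gw; near=> x; under eq_bigr do rewrite subcvE mulmx_e_vec.
rewrite sumrB sum_e_vec.
have [_ ->] : col_stochastic (P x n w).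
  by apply: P_stoch => //; near: x; exact: near_range.
by rewrite subrr.
Unshelve. all: by end_near. Qed.

(** Induction hypothesis on the order. It ranges over all good fibres because the step from [i] to
    [i.+1] uses it at earlier fibres of the orbit. *)
Definition follows i := forall w, Good w -> forall n,
  isbigOmx i (fun x => P x n w *m e_vec R (J w) - e_vec R (J (iter n theta w))).

(** After the first [n - Nm w] steps the law is within [O(x^i)] of the synchronized point mass. This
    difference has sum zero, so the remaining [Nm w] synchronizing steps gain one order. *)
Lemma pullback_extend i w n : follows i -> Good w -> (Nm w <= n)%N ->
  isbigOmx i.+1 (fun x => P x n (back n w) *m e_vec R (J (back n w)) -
    P x (Nm w) (back (Nm w) w) *m e_vec R (J (back (Nm w) w))).
Proof.
move=> Hi Gw Nn; set w1 := back (Nm w) w; set r := (n - Nm w)%N.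
have Gw1 : Good w1 by exact: Good_back.
have wE : back n w = back r w1 by rewrite /w1 -iterD subnK.
pose z x := P x r (back r w1) *m e_vec R (J (back r w1)) - e_vec R (J w1).
have Hz : isbigOmx i z.
  by have := Hi _ (Good_back r Gw1) r; rewrite iter_thetainvK.
have := sync_gain Gw (leqnn _) (sum_P_e_vec r _ _ (Good_back r Gw1)) Hz.
apply: isbigOmx_ext; near=> x.
rewrite /z mulmxBr mulmxA; congr (_ *m _ - _); last by rewrite wE.
by rewrite -cocycle_backD// subnKC.
Unshelve. all: by end_near. Qed.

Lemma entry_expansion i w a n j c : (i < m)%N -> Good w ->
  islittleo i (fun x => P x n w a j - c) ->
  islittleo i.+1 (fun x => P x n w a j - c - Pd i.+1 n w a j / (i.+1)`!%:R * x ^+ i.+1).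
Proof. by move=> im Gw; apply: leading_expansion; exact: A_deriv. Qed.

Lemma follows1 : follows 1.
Proof.
move=> w Gw n.
apply: isbigOmx_ext (isbigOmx_mul (isbigOmx_Pdiff n Gw) (isbigOmx_cst (e_vec R (J w)))).
by near=> x; rewrite mulmxBl J_push.
Unshelve. all: by end_near. Qed.

(** [follows i.+1] kills the Taylor coefficients of orders 1 to [i], and [qvecS_vanish] identifies
    the next derivative with [q^(i+1)]. *)
Lemma pullback_expansion i w a : (i < L)%N -> Good w -> follows i.+1 ->
  islittleo i.+1 (fun x => P x (Nm w) (back (Nm w) w) a (J (back (Nm w) w)) -
    (a == J w)%:R - q i.+1 w a ord0 / (i.+1)`!%:R * x ^+ i.+1).
Proof.
move=> iL Gw Hi; case/andP: L_le => _ Lm.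
have Gb : Good (back (Nm w) w) by exact: Good_back.
rewrite qvecS_vanish; last first.
  by move=> j /andP[j1 ji]; apply: q_vanish => //; rewrite j1 (leq_ltn_trans ji).
rewrite mulmx_e_vec; apply: entry_expansion => //; first exact: leq_trans iL Lm.
apply: isbigOS_islittleo; have := Hi _ Gb (Nm w) a ord0; rewrite iter_thetainvK//.
apply: isbigO_ext; near=> x.
by rewrite subcvE mulmx_e_vec [e_vec _ _ _ _]mxE eqxx andbT.
Unshelve. all: by end_near. Qed.

(** Vanishing of [q^(i+1)] improves the order for pull-backs into a fibre ([far]); two pull-backs
    from a common past then give the statement for forward steps. *)
Lemma followsS i : (i.+1 < L)%N -> follows i.+1 -> follows i.+2.
Proof.
move=> iL Hi; case/andP: L_le => _ Lm.
have far w n : Good w -> (Nm w <= n)%N -> isbigOmx i.+2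
    (fun x => P x n (back n w) *m e_vec R (J (back n w)) - e_vec R (J w)).
  move=> Gw Nn; have Gb : Good (back (Nm w) w) by exact: Good_back.
  have near_w : isbigOmx i.+2 (fun x => P x (Nm w) (back (Nm w) w) *m
      e_vec R (J (back (Nm w) w)) - e_vec R (J w)).
    move=> a b; rewrite (ord1 b).
    have := pullback_expansion a (ltnW iL) Gw Hi.
    rewrite q_vanish ?iL//= mxE mul0r => H.
    have {}H : islittleo i.+1 (fun x => P x (Nm w) (back (Nm w) w) a
        (J (back (Nm w) w)) - (a == J w)%:R).
      by apply: islittleo_ext H; near=> x; rewrite mul0r subr0.
    (* An [o(x^(i+1))] is not yet [O(x^(i+2))]: one more derivative is taken, which exists since
       [i + 2 <= L <= m]. *)
    have := entry_expansion (leq_trans iL Lm) Gb H.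
    move=> /islittleo_isbigO H2.
    have := isbigOD H2 (isbigO_monomial (Pd i.+2 (Nm w) (back (Nm w) w) a
      (J (back (Nm w) w)) / (i.+2)`!%:R) i.+2).
    apply: isbigO_ext; near=> x.
    by rewrite subrK subcvE mulmx_e_vec [e_vec _ _ _ _]mxE eqxx andbT.
  have := isbigOmxD (pullback_extend Hi Gw Nn) near_w.
  by apply: isbigOmx_ext; near=> x; rewrite addrA subrK.
(* [M] exceeds the pull-back times of both [w] and [theta^n w]. The fibre [back M w] is thus far
   enough in the past of each, and [P(n,w)] is the factor relating the two pull-backs. *)
move=> w Gw n; pose M := maxn (Nm w) (Nm (iter n theta w)).
have Gn : Good (iter n theta w) by exact: Good_iter.
have H1 := far w M Gw (leq_maxl _ _).
have H2 : isbigOmx i.+2 (fun x => P x (n + M) (back M w) *m e_vec R (J (back M w)) -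
    e_vec R (J (iter n theta w))).
  have := far _ (M + n)%N Gn (leq_trans (leq_maxr _ _) (leq_addr _ _)).
  by rewrite iterD iter_thetaK// addnC.
have := isbigOmxD H2 (isbigOmx_mul (isbigOmx_P n Gw) (isbigOmx_mul (isbigOmx_cst (- 1%:M)) H1)).
apply: isbigOmx_ext; near=> x.
rewrite mulNmx mul1mx mulmxN mulmxBr mulmxA cocycleD iter_thetainvK//.
by rewrite opprB addrC addrA subrK.
Unshelve. all: by end_near. Qed.

Lemma followsL : follows L.
Proof.
case/andP: L_le => L1 _.
have H l : (l < L)%N -> follows l.+1.
  elim: l => [_|l IH lL]; first exact: follows1.
  by apply: followsS => //; exact: IH (ltnW lL).
by have := H L.-1; rewrite prednK//; exact.
Qed.

(** Successive blocks, each as long as the pull-back time of the fibre where it ends, yield one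
    factor [x] apiece; differences of columns stay of sum zero in between. *)
Lemma forget_initial r w : Good w -> exists2 K, (Nm w <= K)%N &
  forall i j : 'I_k, isbigOmx r (fun x => P x K (back K w) *m (e_vec R i - e_vec R j)).
Proof.
elim: r w => [|r IH] w Gw.
  exists (Nm w) => // i j.
  exact: isbigOmx_mul (isbigOmx_P _ (Good_back _ Gw)) (isbigOmx_cst _).
set w1 := back (Nm w) w; have Gw1 : Good w1 by exact: Good_back.
have [K' NK' HK'] := IH _ Gw1.
exists (Nm w + K')%N => [|i j]; first exact: leq_addr.
have S : \forall x \near (0:R)^'+,
    \sum_(a < k) (P x K' (back K' w1) *m (e_vec R i - e_vec R j)) a ord0 = 0.
  near=> x; under eq_bigr do rewrite mulmxBr subcvE !mulmx_e_vec.
  have [_ S1] : col_stochastic (P x K' (back K' w1)).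
    apply: P_stoch; first exact: Good_back.
    by near: x; exact: near_range.
  by rewrite sumrB !S1 subrr.
have := sync_gain Gw (leqnn _) S (HK' i j).
by apply: isbigOmx_ext; near=> x; rewrite mulmxA -cocycle_backD.
Unshelve. all: by end_near. Qed.

(** Three replacements: column [j] by the synchronized column, [K] by [Nm w], and the remaining
    entry by its expansion. The first two cost [O(x^(L+1))]. *)
Lemma uniform_expansion w : Good w -> exists K, forall a j,
  islittleo L (fun x => P x K (back K w) a j - (a == J w)%:R -
                  q L w a ord0 / L`!%:R * x ^+ L).
Proof.
move=> Gw; have [K NK HK] := forget_initial L.+1 Gw.
exists K => a j.
have H1 := isbigOS_islittleo (HK j (J (back K w)) a ord0).
have H2 := isbigOS_islittleo (pullback_extend followsL Gw NK a ord0).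
have H3 : islittleo L (fun x => P x (Nm w) (back (Nm w) w) a (J (back (Nm w) w)) -
    (a == J w)%:R - q L w a ord0 / L`!%:R * x ^+ L).
  case/andP: L_le => L1 _; have := @pullback_expansion L.-1 w a.
  by rewrite prednK//; apply => //; exact: followsL.
apply: islittleo_ext (islittleoD H1 (islittleoD H2 H3)); near=> x.
rewrite mulmxBr !subcvE !mulmx_e_vec; lra.
Unshelve. all: by end_near. Qed.

Lemma two_sided_bounds w : Good w -> exists (K : nat) (B c : R), 0 < c /\
  \forall x \near (0:R)^'+, forall j,
    1 - P x K (back K w) (J w) j <= B * x ^+ L /\
    (q L w != 0 -> c * x ^+ L <= 1 - P x K (back K w) (J w) j).
Proof.
move=> Gw; have [K HK] := uniform_expansion Gw.
have Gb : Good (back K w) by exact: Good_back.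
pose s a := q L w a ord0 / L`!%:R.
have fL : 0 < (L`!%:R : R) by rewrite ltr0n fact_gt0.
have s_ge0 a : a != J w -> 0 <= s a.
  move=> aJ; apply: expansion_ge0 (islittleo_ext _ (HK a a)).
    near=> x; have [+ _] : col_stochastic (P x K (back K w)).
      by apply: P_stoch => //; near: x; exact: near_range.
    by apply; exact: a.
  by near=> x; rewrite (negbTE aJ) subr0.
(* Summing the expansions over a column: both the column of the stochastic matrix and the point mass
   at [J w] have sum 1. *)
have sumE : islittleo L (fun x => 0 - (\sum_a s a) * x ^+ L).
  have := islittleo_sum (index_enum _) (fun a => HK a (J w)).
  apply: islittleo_ext; near=> x; rewrite !sumrB -mulr_suml; congr (_ - _).
  have [_ ->] : col_stochastic (P x K (back K w)).
    by apply: P_stoch => //; near: x; exact: near_range.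
  rewrite (bigD1 (J w))//= eqxx big1 ?addr0 ?subrr// => a aJ.
  by rewrite (negbTE aJ).
have sum0 : \sum_a s a = 0.
  apply/eqP; rewrite eq_le; apply/andP; split.
    rewrite -oppr_ge0; apply: expansion_ge0 (islittleo_ext _ (islittleoN sumE)).
      by apply: nearW => x; exact: lexx.
    by near=> x; rewrite opprB mulNr subr0 sub0r opprK.
  by apply: expansion_ge0 sumE; apply: nearW => x; exact: lexx.
pose c := - s (J w) / 2.
have c0 : q L w != 0 -> 0 < c.
  move=> q0; rewrite divr_gt0// oppr_gt0 ltNge; apply/negP => sJ.
  have s0 a : 0 <= s a by have [->//|] := eqVneq a (J w); exact: s_ge0.
  case/negP: q0; apply/eqP/matrixP => a b; rewrite (ord1 b) mxE.
  have /eqP : s a = 0.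
    apply/eqP; move: sum0 => /eqP; rewrite psumr_eq0// => /allP/(_ a).
    by rewrite mem_index_enum; exact.
  by rewrite mulf_eq0 invr_eq0 (gt_eqF fL) orbF => /eqP.
(* The upper constant takes the remainder with factor 1; the lower one spends half of [- s (J w)] on
   it. The value 1 is a placeholder, since the lower bound is claimed only if [q L w != 0]. *)
exists K, (1 - s (J w)), (if q L w == 0 then 1 else c); split.
  by case: eqVneq => [_|/c0 //].
have upper : \forall x \near (0:R)^'+, forall j,
    `|P x K (back K w) (J w) j - (J w == J w)%:R - s (J w) * x ^+ L| <= 1 * x ^+ L.
  by apply: filter_forall => i; exact: HK.
have lower : \forall x \near (0:R)^'+, q L w != 0 -> forall j,
    `|P x K (back K w) (J w) j - (J w == J w)%:R - s (J w) * x ^+ L| <= c * x ^+ L.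
  case: (eqVneq (q L w) 0) => [_|/c0 cp]; first exact: nearW.
  have : \forall x \near (0:R)^'+, forall j,
      `|P x K (back K w) (J w) j - (J w == J w)%:R - s (J w) * x ^+ L| <= c * x ^+ L.
    by apply: filter_forall => i; exact: HK.
  by apply: filterS.
apply: filterS2 upper lower => x U Lo j; split.
  move: (U j); rewrite eqxx /= mulr1n mul1r ler_norml => /andP[+ _].
  by rewrite mulrBl mul1r; lra.
move=> q0; rewrite (negbTE q0); move: (Lo q0 j).
rewrite eqxx /= mulr1n ler_norml => /andP[_]; rewrite /c.
have -> : - s (J w) / 2 * x ^+ L = - (s (J w) * x ^+ L) / 2 by rewrite mulrAC mulNr.
lra.
Unshelve. all: by end_near. Qed.

End Pointwise.

(** * Lower frequency of visits for an ergodic map *)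

Section MeasurableSets.
Context {R : realType} (d : measure_display) (T : measurableType d).

Lemma measurable_exists (I : countType) (F : I -> set T) :
  (forall i, measurable (F i)) -> measurable [set w | exists i, F i w].
Proof.
move=> mF; rewrite (_ : [set w | _] = \bigcup_i F i).
  by apply: countable_bigcupT_measurable.
by apply/seteqP; split=> w /= [i]; [exists i|move=> _ Fw; exists i].
Qed.

Lemma measurable_forall (I : countType) (F : I -> set T) :
  (forall i, measurable (F i)) -> measurable [set w | forall i, F i w].
Proof.
move=> mF; rewrite (_ : [set w | _] = ~` [set w | exists i, (~` F i) w]).
  by apply: measurableC; apply: measurable_exists => i; exact: measurableC.
apply/seteqP; split=> w /= H; first by move=> [i]; apply.
by move=> i; apply: contrapT => nF; apply: H; exists i.
Qed.

Lemma measurable_imply_prop (Q : Prop) (F : set T) :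
  (Q -> measurable F) -> measurable [set w | Q -> F w].
Proof.
move=> mF; have [q|nq] := pselect Q.
  by rewrite (_ : [set w | _] = F); [exact: mF|apply/seteqP; split=> w /=; [exact|]].
rewrite (_ : [set w | _] = setT); first exact: measurableT.
by apply/seteqP; split=> w //= _ /nq.
Qed.

Lemma measurable_and_prop (Q : Prop) (F : set T) :
  (Q -> measurable F) -> measurable [set w | Q /\ F w].
Proof.
move=> mF; have [q|nq] := pselect Q.
  rewrite (_ : [set w | _] = F); first exact: mF.
  by apply/seteqP; split=> w /= => [[]|].
rewrite (_ : [set w | _] = set0); first exact: measurable0.
by apply/seteqP; split=> w // [].
Qed.

Lemma measurable_le (f g : T -> R) : measurable_fun setT f ->
  measurable_fun setT g -> measurable [set w | f w <= g w].
Proof.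
by move=> mf mg; have := measurable_fun_le measurableT mf mg; rewrite setTI.
Qed.

(** Continuity from below: a constant that exists for almost every [w] can be fixed once for all
    outside a set of small measure. *)
Lemma exhaustion (mu : probability T R) (H : nat -> set T) :
  (forall n, measurable (H n)) -> (forall n, H n `<=` H n.+1) ->
  {ae mu, forall w, exists n, H n w} ->
  forall e : R, 0 < e -> exists n, (mu (~` H n) < e%:E)%E.
Proof.
move=> mH ndH aeH e e0.
have mU : measurable (\bigcup_n H n) by exact: bigcupT_measurable.
have muU : mu (\bigcup_n H n) = 1%E.
  have : mu (~` \bigcup_n H n) = 0%E.
    apply: measure_negligible; first exact: measurableC.
    apply: negligibleS aeH => w /= nU [n Hn]; apply: nU; by exists n.
  rewrite probability_setC// => /eqP; rewrite sube_eq ?add0e ?fin_num_measure//.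
    by move/eqP.
have nd : nondecreasing_seq H.
  by apply/nondecreasing_seqP => n; apply/subsetPset; exact: ndH.
have cv : mu \o H @ \oo --> 1%E by rewrite -muU; exact: nondecreasing_cvg_mu.
have : \forall n \near \oo, ((1 - e)%:E < (mu \o H) n)%E.
  have := cv [set y | ((1 - e)%:E < y)%E]; apply.
  by apply: open_ereal_gt'; rewrite lte_fin gtrBl.
case=> n _ /(_ n (leqnn _)) /= Hn; exists n.
rewrite probability_setC//.
have : mu (H n) \is a fin_num by rewrite fin_num_measure.
move: Hn; case: (mu (H n)) => // r; rewrite !lte_fin; lra.
Qed.

End MeasurableSets.

Section Ergodic.
Context {R : realType} (d : measure_display) (Omega : measurableType d).
Variables (mu : probability Omega R) (theta : Omega -> Omega).
Hypothesis mtheta : measurable_fun setT theta.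
Hypothesis theta_mu : forall B, measurable B -> mu (theta @^-1` B) = mu B.
Hypothesis theta_erg : forall B, measurable B -> theta @^-1` B = B ->
  mu B = 0%E \/ mu B = 1%E.

Definition pr (B : set Omega) : R := fine (mu B).

Lemma muE B : measurable B -> mu B = (pr B)%:E.
Proof. by move=> mB; rewrite /pr fineK// fin_num_measure. Qed.

Lemma ae_theta (Q : Omega -> Prop) :
  {ae mu, forall w, Q w} -> {ae mu, forall w, Q (theta w)}.
Proof.
move=> [N [mN N0 QN]]; exists (theta @^-1` N); split.
- by rewrite -[_ @^-1` _]setTI; exact: mtheta.
- by rewrite theta_mu.
- by move=> w /= nQ; apply: QN.
Qed.

Lemma measurable_iter n : measurable_fun setT (iter n theta).
Proof.
elim: n => [|n IH]; first exact: measurable_id.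
exact: measurableT_comp mtheta IH.
Qed.

Lemma iter_mu n B : measurable B -> mu (iter n theta @^-1` B) = mu B.
Proof.
elim: n B => [//|n IH] B mB.
have -> : iter n.+1 theta @^-1` B = iter n theta @^-1` (theta @^-1` B) by [].
rewrite IH ?theta_mu// -[_ @^-1` _]setTI; exact: mtheta.
Qed.

Definition visits (B : set Omega) n w : R := \sum_(i < n) \1_B (iter i theta w).

Lemma visitsD B a b w :
  visits B (a + b) w = visits B a w + visits B b (iter a theta w).
Proof.
rewrite /visits big_split_ord/=; congr (_ + _); apply: eq_bigr => i _.
by rewrite addnC iterD.
Qed.

Lemma visitsS B n w : visits B n.+1 w = \1_B w + visits B n (theta w).
Proof. by rewrite -add1n visitsD /visits big_ord_recl big_ord0 addr0. Qed.

Lemma visitsSr B n w : visits B n.+1 w = visits B n w + \1_B (iter n theta w).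
Proof. by rewrite /visits big_ord_recr. Qed.

Lemma indic_le1 (B : set Omega) w : 0 <= (\1_B w : R) <= 1.
Proof. by rewrite indicE; case: (_ \in _); rewrite ?lexx ?ler01. Qed.

Lemma visits_ge0 B n w : 0 <= visits B n w.
Proof. by apply: sumr_ge0 => i _; case/andP: (indic_le1 B (iter i theta w)). Qed.

Lemma visits_len B n w : visits B n w <= n%:R.
Proof.
rewrite -[n in n%:R]card_ord -sum1_card natr_sum; apply: ler_sum => i _.
by case/andP: (indic_le1 B (iter i theta w)).
Qed.

Lemma visits_subset B C n w : B `<=` C -> visits B n w <= visits C n w.
Proof.
move=> BC; apply: ler_sum => i _; rewrite !indicE ler_nat.
case: (boolP (_ \in B)) => //; rewrite inE => /BC Cw.
by rewrite mem_set.
Qed.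

Lemma measurable_visits B n : measurable B -> measurable_fun setT (visits B n).
Proof.
move=> mB; apply: measurable_sum => i.
apply: (measurableT_comp (measurable_indic mB)).
exact: measurable_iter.
Qed.

Lemma integral_visits B n : measurable B ->
  (\int[mu]_w (visits B n w)%:E)%E = (n%:R * pr B)%:E.
Proof.
move=> mB; rewrite /visits.
under eq_integral do rewrite -sumEFin.
have mBi i : measurable (iter i theta @^-1` B).
  by rewrite -[_ @^-1` _]setTI; exact: measurable_iter.
rewrite ge0_integral_sum//; first last.
- move=> i; apply/measurable_EFinP.
  by apply: (measurableT_comp (measurable_indic mB)); exact: measurable_iter.
rewrite (eq_bigr (fun=> (pr B)%:E)) => [|i _].
  by rewrite sumEFin sumr_const card_ord mulr_natl.
rewrite -muE// -(iter_mu i mB) -[in RHS](setIT (_ @^-1` B)) -integral_indic//.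
Qed.

Lemma integral_cstT (c : R) : (\int[mu]_w c%:E)%E = c%:E.
Proof.
transitivity (c%:E * mu setT)%E; first exact: integral_cst.
by rewrite probability_setT mule1.
Qed.

(* Orbit covering of Katznelson and Weiss: outside [hit s M], count a visit for
   free; inside, jump along a stretch of length at most [M] of frequency [s]. *)
Definition hit B (s : R) M : set Omega :=
  [set w | exists n, (1 <= n <= M)%N /\ s * n%:R <= visits B n w].

(** The defect [s * M] pays for the last stretch, of length at most [M], which may be left
    incomplete. *)
Lemma orbit_covering B s M : 0 <= s <= 1 -> forall N w,
  s * N%:R <= visits (B `|` ~` hit B s M) N w + s * M%:R.
Proof.
move=> /andP[s0 s1]; elim/ltn_ind => N IH w.
have [NM|MN] := leqP N M.
  rewrite (le_trans (_ : _ <= s * M%:R))// ?lerDr ?visits_ge0//.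
  by rewrite ler_wpM2l// ler_nat.
have [|nhit] := pselect (hit B s M w).
  move=> [n [/andP[n1 nM] Hn]].
  have nN : (n <= N)%N by exact: ltnW (leq_ltn_trans nM MN).
  rewrite -(subnKC nN) visitsD natrD mulrDr -addrA lerD//; last first.
    by apply: IH; rewrite ltn_subrL n1 (leq_ltn_trans _ MN).
  by rewrite (le_trans Hn)//; apply: visits_subset; exact: subsetUl.
case: N MN IH => // N MN IH; rewrite visitsS -natr1 mulrDr mulr1.
have := IH N (ltnSn _) (theta w).
rewrite indicE mem_set; last by right.
by rewrite /=; lra.
Qed.

(** The event that the limsup of [visits B n w / n] exceeds [s], with countable quantifiers so that
    it is visibly measurable. *)
Definition often B (s : R) : set Omega := [set w | exists j : nat,
  forall n0 : nat, exists n : nat, (n0 <= n)%N /\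
  (s + j.+1%:R^-1) * n%:R <= visits B n w].

Lemma measurable_visits_ge B (c : R) n : measurable B ->
  measurable [set w | c <= visits B n w].
Proof.
by move=> mB; apply: measurable_le; [exact: measurable_cst|exact: measurable_visits].
Qed.

Lemma measurable_often B s : measurable B -> measurable (often B s).
Proof.
move=> mB; apply: measurable_exists => j; apply: measurable_forall => n0.
apply: measurable_exists => n; apply: measurable_and_prop => _.
exact: measurable_visits_ge.
Qed.

Lemma often_shift s (v v' : nat -> R) :
  (forall n, `|v n - v' n| <= 1) ->
  (exists j : nat, forall n0 : nat, exists n : nat, (n0 <= n)%N /\
    (s + j.+1%:R^-1) * n%:R <= v n) ->
  (exists j : nat, forall n0 : nat, exists n : nat, (n0 <= n)%N /\
    (s + j.+1%:R^-1) * n%:R <= v' n).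
Proof.
(* Half of the gap is given up: [1/(j+1) = 2/(2j+2)], and for [n >= 2j+2] the half [n/(2j+2)] covers
   the error 1. *)
move=> vv' [j Hj]; exists (j.*2.+1) => n0.
have [n [n0n Hn]] := Hj (maxn n0 (j.*2.+2)).
exists n; split; first exact: leq_trans (leq_maxl _ _) n0n.
have nj : (j.*2.+2 <= n)%N by exact: leq_trans (leq_maxr _ _) n0n.
have E : (j.+1%:R^-1 : R) = 2 * j.*2.+2%:R^-1.
  by rewrite -doubleS -mul2n natrM invfM mulrA divff ?mul1r ?pnatr_eq0.
have : 1 <= (j.*2.+2%:R^-1 : R) * n%:R.
  by rewrite mulrC ler_pdivlMr ?ltr0n// mul1r ler_nat.
have := vv' n; rewrite ler_norml => /andP[_].
move: Hn; rewrite E !mulrDl -mulrA; move: (_^-1 * n%:R) (s * n%:R) (v n) (v' n).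
by move=> t a b c; lra.
Qed.

(** Visit counts from [w] and from [theta w] differ by at most 1, so the invariance is exact, as the
    ergodicity hypothesis requires. *)
Lemma often_invariant B s : theta @^-1` often B s = often B s.
Proof.
have vv w n : `|visits B n w - visits B n (theta w)| <= 1.
  have := visitsS B n w; rewrite visitsSr => /eqP.
  have /andP[] := indic_le1 B w; have /andP[] := indic_le1 B (iter n theta w).
  move=> ? ? ? ? /eqP H; rewrite ler_norml; apply/andP; split; lra.
apply/seteqP; split=> w; apply: often_shift => n //.
by rewrite distrC.
Qed.

(** By ergodicity the alternative is full measure. Then for large [M] the set [C], made of [B] and
    the complement of [hit B s M], still has measure below [s], while integrating [orbit_covering]
    gives [s N <= N pr C + s M] for every [N]. *)
Lemma often_null B s : measurable B -> pr B < s -> mu (often B s) = 0%E.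
Proof.
move=> mB prs; have mD := measurable_often s mB.
have [//|D1] := theta_erg mD (often_invariant B s).
have pr0 : 0 <= pr B by rewrite fine_ge0.
have hitD w : often B s w -> exists M, hit B s M w.
  move=> [j /(_ 1%N)[n [n1 Hn]]]; exists n, n; split; first by rewrite n1 leqnn.
  by apply: le_trans Hn; rewrite ler_wpM2r// lerDl.
have aeD : {ae mu, forall w, often B s w}.
  exists (~` often B s); split => //; first exact: measurableC.
  by rewrite probability_setC// D1 subee.
have s1 : s <= 1.
  have [w [M [n [/andP[n1 _] Hn]]]] : exists w, exists M, hit B s M w.
    suff [w Dw] : exists w, often B s w by exists w; exact: hitD.
    apply: contrapT => /forallNP nD; move: D1.
    rewrite (_ : often B s = set0) ?measure0; last by apply/seteqP; split=> w // /nD.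
    by move=> /eqP; rewrite eqe eq_sym oner_eq0.
  have := le_trans Hn (visits_len B n w).
  by rewrite -[leRHS]mul1r ler_pM2r// ltr0n.
have s0 : 0 <= s by exact: le_trans pr0 (ltW prs).
have mhit M : measurable (hit B s M).
  apply: measurable_exists => n; apply: measurable_and_prop => _.
  exact: measurable_visits_ge.
have [M HM] : exists M, (mu (~` hit B s M) < (s - pr B)%:E)%E.
  apply: exhaustion => //; last by rewrite subr_gt0.
    move=> M w [n [/andP[n1 nM] Hn]]; exists n; split=> //.
    by rewrite n1 (leq_trans nM).
  by apply: filterS aeD => w; exact: hitD.
pose C := B `|` ~` hit B s M.
have mC : measurable C by apply: measurableU => //; exact: measurableC.
have prC : pr C < s.
  rewrite -lte_fin -muE//; apply: le_lt_trans (measureU2 _ _ _) _ => //.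
    exact: measurableC.
  have -> : s%:E = ((pr B)%:E + (s - pr B)%:E)%E.
    by rewrite -EFinD [pr B + _]addrC subrK.
  apply: lee_ltD => //; first by rewrite fin_num_measure.
  by rewrite -muE//; exact: lexx.
have key N : s * N%:R <= N%:R * pr C + s * M%:R.
  have : (\int[mu]_w (s * N%:R)%:E <= \int[mu]_w (visits C N w + s * M%:R)%:E)%E.
    apply: ge0_le_integral => //.
    - by move=> w _; rewrite lee_fin mulr_ge0.
    - apply/measurable_EFinP; apply: measurable_funD; last exact: measurable_cst.
      exact: measurable_visits.
    - by move=> w _; rewrite lee_fin; apply: orbit_covering; rewrite s0.
  rewrite integral_cstT.
  under [X in (_ <= X)%E]eq_integral do rewrite EFinD.
  rewrite ge0_integralD//.
  - by rewrite integral_visits// integral_cstT -EFinD lee_fin.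
  - by move=> w _; rewrite lee_fin visits_ge0.
  - by apply/measurable_EFinP; exact: measurable_visits.
  - by move=> w _; rewrite lee_fin mulr_ge0.
have d0 : 0 < s - pr C by rewrite subr_gt0.
have [N HN] : exists N : nat, s * M%:R / (s - pr C) < N%:R.
  by exists (Num.truncn (s * M%:R / (s - pr C))).+1; exact: truncnS_gt.
exfalso; have := key N; move: HN; rewrite ltr_pdivrMr// mulrBr (mulrC N%:R s).
by move: (s * _) (s * N%:R) (N%:R * _) => x y z; lra.
Qed.

Theorem ergodic_lower_frequency G : measurable G ->
  {ae mu, forall w, forall eta : R, 0 < eta -> exists n0 : nat, forall n : nat,
    (n0 <= n)%N -> (pr G - eta) * n%:R <=
    \sum_(1 <= i < n.+1) (\1_G (iter i theta w) : R)}.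
Proof.
move=> mG; pose B := ~` G; have mB : measurable B by exact: measurableC.
have prB : pr B = 1 - pr G by rewrite /pr probability_setC// muE.
have : {ae mu, forall w, forall j : nat, ~ often B (pr B + j.+1%:R^-1) w}.
  apply: ae_foralln => j; exists (often B (pr B + j.+1%:R^-1)); split.
  - exact: measurable_often.
  - by apply: often_null => //; rewrite ltrDl invr_gt0.
  - by move=> w /= /contrapT.
(* The sum runs over the times 1 to [n] and [visits] over 0 to [n - 1], hence the passage to
   [theta w]. *)
move=> /ae_theta; apply: filterS => w Hw eta eta0.
(* The gap [1/(j+1)] is spent twice: in the threshold given to [often], and inside [often]
   itself. *)
have [j Hj] : exists j : nat, 2 * (j.+1%:R^-1 : R) < eta.
  exists (Num.truncn (2 / eta)).
  have : 2 / eta < (Num.truncn (2 / eta)).+1%:R by exact: truncnS_gt.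
  by rewrite ltr_pdivrMr// => ?; rewrite ltr_pdivrMr// mulrC.
have /forallNP/(_ j)/existsNP[n0 Hn0] := Hw j.
exists n0 => n n0n.
have {}Hn0 : visits B n (theta w) < (pr B + j.+1%:R^-1 + j.+1%:R^-1) * n%:R.
  rewrite ltNge; apply/negP => H; apply: Hn0; by exists n.
have E : \sum_(1 <= i < n.+1) (\1_G (iter i theta w) : R) =
    n%:R - visits B n (theta w).
  rewrite big_add1/= big_mkord -[n in n%:R]card_ord -sum1_card natr_sum -sumrB.
  apply: eq_bigr => i _; rewrite -iterSr !indicE /B in_setC.
  by case: (_ \in _); rewrite ?subr0 ?subrr.
have : 2 * j.+1%:R^-1 * n%:R <= eta * n%:R by rewrite ler_wpM2r// ltW.
move: Hn0; rewrite E prB.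
by move: (_^-1) (pr G) (visits _ _ _) (n%:R) => r g u v; lra.
Qed.

End Ergodic.

(** * Frequencies, meeting probabilities, right continuity *)

Section LowerFrequency.
Context {R : realType}.
Implicit Types (S : set nat) (s : R).

(** The liminf of the density is at least [s], in a form free of division in which frequency
    deficits add up under intersection. *)
Definition lowfreq S s : Prop := forall eta, 0 < eta -> exists n0 : nat,
  forall n, (n0 <= n)%N -> (s - eta) * n%:R <= \sum_(1 <= i < n.+1) (\1_S i : R).

Lemma lowfreqI S S' s s' : lowfreq S s -> lowfreq S' s' ->
  lowfreq (S `&` S') (s + s' - 1).
Proof.
move=> HS HS' eta eta0; have e2 : 0 < eta / 2 by rewrite divr_gt0.
have [n1 H1] := HS _ e2; have [n2 H2] := HS' _ e2.
exists (maxn n1 n2) => n; rewrite geq_max => /andP[/H1 {}H1 /H2 {}H2].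
have : \sum_(1 <= i < n.+1) (\1_S i : R) + \sum_(1 <= i < n.+1) (\1_S' i : R)
    - n%:R <= \sum_(1 <= i < n.+1) (\1_(S `&` S') i : R).
  have -> : n%:R = \sum_(1 <= i < n.+1) (1 : R).
    by rewrite sumr_const_nat subSS subn0.
  rewrite -big_split/= -sumrB; apply: ler_sum => i _.
  rewrite !indicE in_setI.
  by case: (i \in S); case: (i \in S'); rewrite /=; lra.
move: H1 H2; move: (\sum_(1 <= i < n.+1) _) (\sum_(1 <= i < n.+1) _) (\sum_(1 <= i < n.+1) _).
by move=> x y z; move: (n%:R) => v; lra.
Qed.

Lemma lowfreq_offset S s (c : R) : 0 <= c -> (forall n,
  s * n%:R - c <= \sum_(1 <= i < n.+1) (\1_S i : R)) -> lowfreq S s.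
Proof.
move=> c0 HS eta eta0; exists (Num.truncn (c / eta)).+1 => n nn.
apply: le_trans (HS n); rewrite mulrBl lerD2l lerN2 -ler_pdivrMl// mulrC.
rewrite (le_trans (ltW (truncnS_gt _)))// ler_nat//.
Qed.

Lemma lowfreq_geq N : lowfreq [set n | (N <= n)%N] 1.
Proof.
apply: (@lowfreq_offset _ _ N%:R) => // n; rewrite mul1r.
elim: n => [|n IH]; first by rewrite big_geq// sub0r oppr_le0.
rewrite big_nat_recr//= indicE; have [Nn|nN] := leqP N n.+1.
  by rewrite mem_set//= -natr1; move: IH; lra.
rewrite memNset /=; last by rewrite leqNgt nN.
rewrite addr0 (@le_trans _ _ 0)//; last first.
  by apply: sumr_ge0 => i _; rewrite indicE; case: (_ \in _).
by rewrite subr_le0 ler_nat ltnW.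
Qed.

Lemma lowfreq_parity b : lowfreq [set n | odd n = b] 2^-1.
Proof.
apply: (@lowfreq_offset _ _ 1) => // n.
(* The induction must record at which parity of [n] the deficit of one half may occur. *)
suff H : forall n, n%:R / 2 - (if odd n == b then 0 else 2^-1) <=
    \sum_(1 <= i < n.+1) (\1_[set n | odd n = b] i : R) by
  apply: le_trans (H n); rewrite mulrC; case: ifP => _; lra.
elim=> [|{}n IH]; first by rewrite big_geq//; case: ifP => _; lra.
rewrite big_nat_recr//= indicE -natr1.
have [ob|nob] := eqVneq (~~ odd n) b.
  rewrite mem_set//=; move: IH.
  by rewrite -ob; case: (odd n) => /=; lra.
rewrite memNset //=; last exact/eqP.
move: IH nob; case: (odd n); case: b => //=; lra.
Qed.

Lemma lowfreq_limn_einf S s x : lowfreq S s -> x < s ->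
  (x%:E < limn_einf (fun n => (dens S n : R)%:E))%E.
Proof.
move=> HS xs; have e0 : 0 < (s - x) / 2 by rewrite divr_gt0// subr_gt0.
have [n0 Hn0] := HS _ e0.
apply: (@lt_le_trans _ _ (s - (s - x) / 2)%:E).
  by rewrite lte_fin; lra.
rewrite limn_einf_lim; apply: lime_ge; first exact: is_cvg_einfs.
exists (maxn n0 1) => // n /=; rewrite geq_max => /andP[n0n n1].
apply: le_ereal_inf_tmp => _ [p /= np <-]; rewrite lee_fin /dens.
rewrite ler_pdivlMr ?ltr0n ?(leq_trans n1 np)//; apply: Hn0.
exact: leq_trans n0n np.
Qed.

End LowerFrequency.

Section MeetingProbability.
Context {R : realType} (k : nat).
Implicit Types (M : 'M[R]_k) (u v : 'cV[R]_k).

(** The missing mass at [a] is the [u]-average of the missing masses of the columns, so bounds on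
    columns hold for every initial law. *)
Lemma average_bounds M u a (lo hi : R) : prob_vector u ->
  (forall j, lo <= 1 - M a j <= hi) -> lo <= 1 - (M *m u) a ord0 <= hi.
Proof.
move=> [u0 u1] H.
have E : 1 - (M *m u) a ord0 = \sum_(j < k) (1 - M a j) * u j ord0.
  by under eq_bigr do rewrite mulrBl mul1r; rewrite sumrB u1 mxE.
have cE (c : R) : c = \sum_(j < k) c * u j ord0 by rewrite -mulr_sumr u1 mulr1.
rewrite E [lo]cE [hi]cE; apply/andP; split; apply: ler_sum => j _;
  by apply: ler_wpM2r => //; case/andP: (H j).
Qed.

Lemma prob_vector_le1 u a : prob_vector u -> u a ord0 <= 1.
Proof. by move=> [u0 u1]; rewrite -u1 (bigD1 a)//= lerDl sumr_ge0. Qed.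

Lemma meet_lower u v a : prob_vector u -> prob_vector v ->
  1 - \sum_(i < k) u i ord0 * v i ord0 <= (1 - u a ord0) + (1 - v a ord0).
Proof.
move=> pu pv; have [u0 _] := pu; have [v0 _] := pv.
have : u a ord0 * v a ord0 <= \sum_(i < k) u i ord0 * v i ord0.
  by rewrite (bigD1 a)//= lerDl sumr_ge0// => i _; rewrite mulr_ge0.
have : 0 <= (1 - u a ord0) * (1 - v a ord0).
  by rewrite mulr_ge0// subr_ge0 prob_vector_le1.
move: (\sum_(i < k) _) (u a ord0) (v a ord0) => s x y; lra.
Qed.

(** The meeting probability is the [u]-average of the entries of [v], and an entry that is at least
    one half is the largest. *)
Lemma meet_upper u v a : prob_vector u -> prob_vector v ->
  2^-1 <= v a ord0 ->
  1 - v a ord0 <= 1 - \sum_(i < k) u i ord0 * v i ord0.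
Proof.
move=> [u0 u1] [v0 v1] va; rewrite lerD2l lerN2.
rewrite -[leRHS]mul1r -u1 mulr_suml; apply: ler_sum => i _.
rewrite ler_wpM2l//; have [->//|ia] := eqVneq i a.
suff : v i ord0 + v a ord0 <= 1 by move: va; lra.
rewrite -v1 (bigD1 a)//= (bigD1 i)//= addrCA addrA lerDl.
by rewrite sumr_ge0.
Qed.

End MeetingProbability.

Section RightContinuity.
Context {R : realType}.
Implicit Types (f g : R -> R) (e : R).

Definition rcts e f : Prop :=
  forall x, 0 <= x < e -> f y @[y --> x^'+] --> f x.

Lemma rcts_cst e (c : R) : rcts e (fun=> c).
Proof. by move=> x _; exact: cvg_cst. Qed.

Lemma rctsD e f g : rcts e f -> rcts e g -> rcts e (fun x => f x + g x).
Proof. by move=> Hf Hg x xe; apply: cvgD; [exact: Hf|exact: Hg]. Qed.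

Lemma rctsB e f g : rcts e f -> rcts e g -> rcts e (fun x => f x - g x).
Proof. by move=> Hf Hg x xe; apply: cvgB; [exact: Hf|exact: Hg]. Qed.

Lemma rctsM e f g : rcts e f -> rcts e g -> rcts e (fun x => f x * g x).
Proof. by move=> Hf Hg x xe; apply: cvgM; [exact: Hf|exact: Hg]. Qed.

Lemma rcts_id e : rcts e id.
Proof. by move=> x _; exact/cvg_at_right_filter/cvg_id. Qed.

Lemma rctsX e n : rcts e (fun x => x ^+ n).
Proof.
elim: n => [|n IH]; first exact: rcts_cst.
by under eq_fun do rewrite exprS; apply: rctsM => //; exact: rcts_id.
Qed.

Lemma rcts_sum e (I : Type) (s : seq I) (F : I -> R -> R) :
  (forall i, rcts e (F i)) -> rcts e (fun x => \sum_(i <- s) F i x).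
Proof.
move=> HF; elim: s => [|i s IH].
  by under eq_fun do rewrite big_nil; exact: rcts_cst.
by under eq_fun do rewrite big_cons; exact: rctsD.
Qed.

Lemma rcts_mulmx e p q r (M : R -> 'M[R]_(p, q)) (N : R -> 'M[R]_(q, r)) :
  (forall a b, rcts e (fun x => M x a b)) ->
  (forall a b, rcts e (fun x => N x a b)) ->
  forall a b, rcts e (fun x => (M x *m N x) a b).
Proof.
move=> HM HN a b; under eq_fun do rewrite mxE.
by apply: rcts_sum => i; exact: rctsM.
Qed.

Lemma Cm_on_rcts e m f : (1 <= m)%N -> Cm_on e m f -> rcts e f.
Proof.
move=> m1 [Ds [D0 D1 _]] x xe; have /andP[x0 xlt] := xe.
have := deriv_on_right_cts (D1 _ m1) xe.
rewrite D0 ?x0 ?ltW//; apply: cvg_trans; apply: near_eq_cvg; near=> y.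
apply: D0; rewrite (le_trans x0)/=; last by apply: ltW.
by near: y; exact: nbhs_right_le.
Unshelve. all: by end_near. Qed.

Lemma rcts_ge0_rat e e' f : rcts e f -> e' <= e ->
  (forall r : rat, 0 < (ratr r : R) < e' -> 0 <= f (ratr r)) ->
  forall x, 0 <= x < e' -> 0 <= f x.
Proof.
move=> Hf ee' Hr x /andP[x0 xe'].
have xe : 0 <= x < e by rewrite x0 (lt_le_trans xe').
rewrite leNgt; apply/negP => fx.
have : \forall y \near x^'+, f y < 0 by exact: cvgr_lt (Hf _ xe) _ fx.
rewrite near_withinE => /nbhs_ballP[r /= r0 Br].
have xm : x < Num.min (x + r) e' by rewrite lt_min ltrDl r0.
have [t] := rat_in_itvoo xm; rewrite in_itv/= lt_min => /and3P[xt tr te].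
have := Hr t; rewrite (le_lt_trans x0 xt) te => /(_ isT).
rewrite leNgt; apply/negP; rewrite negbK; apply: Br => //.
by rewrite /ball/= distrC gtr0_norm ?subr_gt0// ltrBlDl.
Qed.

End RightContinuity.

(** * Almost sure orbits and measurability *)

Section OrbitStable.
Context {R : realType} (d : measure_display) (Omega : measurableType d).
Variables (mu : probability Omega R) (theta thetainv : Omega -> Omega).
Hypothesis mds : invertible_mds mu theta thetainv.

Lemma thetainv_mu B : measurable B -> mu (thetainv @^-1` B) = mu B.
Proof.
case: mds => [[K1 K2] mt mi Hmu _] mB.
have mB' : measurable (thetainv @^-1` B) by rewrite -[_ @^-1` _]setTI; exact: mi.
rewrite -Hmu//; congr (mu _); apply/seteqP; split=> w /=; by rewrite K1.
Qed.

(** [Good] asks for [Q] along the whole two-sided orbit: a countable intersection of sets of full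
    measure, invariant by construction. *)
Lemma ae_orbit (Q : Omega -> Prop) : {ae mu, forall w, Q w} ->
  exists Good : set Omega, [/\ {ae mu, forall w, Good w},
    (forall w, Good w -> Q w),
    (forall w, Good w -> Good (theta w)) &
    (forall w, Good w -> Good (thetainv w))].
Proof.
case: mds => [[K1 K2] mt mi Hmu _] aeQ.
exists [set w | forall n, Q (iter n theta w) /\ Q (iter n thetainv w)]; split.
- apply: ae_foralln => n.
  have H1 : {ae mu, forall w, Q (iter n theta w)}.
    elim: n => [//|n IH]; have := ae_theta mt Hmu IH.
    by apply: filterS => w; rewrite iterSr.
  have H2 : {ae mu, forall w, Q (iter n thetainv w)}.
    elim: n {H1} => [//|n IH]; have := ae_theta mi thetainv_mu IH.
    by apply: filterS => w; rewrite iterSr.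
  by apply: filterS2 H1 H2.
- by move=> w /(_ 0%N)[].
- move=> w Gw n; split; first by rewrite -iterSr; case: (Gw n.+1).
  case: n => [|n]; first by case: (Gw 1%N).
  by rewrite iterSr K1; case: (Gw n).
- move=> w Gw n; split; last by rewrite -iterSr; case: (Gw n.+1).
  case: n => [|n]; first by case: (Gw 1%N).
  by rewrite iterSr K2; case: (Gw n).
Qed.

End OrbitStable.

Section Measurability.
Context {R : realType} (d : measure_display) (Omega : measurableType d).

(** Handles the random indices [J w] and [Nm w], in particular the fibre [iter (Nm w) thetainv w] in
    the recursion for [q]. *)
Lemma measurable_fun_index (I : countType) (N : Omega -> I) (f : I -> Omega -> R) :
  (forall i, measurable (N @^-1` [set i])) ->
  (forall i, measurable_fun setT (f i)) ->
  measurable_fun setT (fun w => f (N w) w).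
Proof.
move=> mN mf _ Y mY; rewrite setTI.
rewrite (_ : _ @^-1` _ = [set w | exists i, (N @^-1` [set i] `&` f i @^-1` Y) w]).
  apply: measurable_exists => i; apply: measurableI => //.
  by rewrite -[_ @^-1` _]setTI; exact: mf.
apply/seteqP; split=> w /=; first by move=> Yw; exists (N w).
by move=> [i [<-]].
Qed.

Lemma measurable_cocycle k (theta : Omega -> Omega) (B : Omega -> 'M[R]_k) n a b :
  measurable_fun setT theta ->
  (forall a b, measurable_fun setT (fun w => B w a b)) ->
  measurable_fun setT (fun w => cocycle theta B n w a b).
Proof.
move=> mt mB; elim: n a b => [|n IH] a b /=; first exact: measurable_cst.
under eq_fun do rewrite mxE.
apply: measurable_sum => c; apply: measurable_funM => //.
by apply: (measurableT_comp (mB a c)); exact: measurable_iter.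
Qed.

Lemma measurable_qvec k (thetainv : Omega -> Omega) (J : Omega -> 'I_k)
  (Nm : Omega -> nat) (Pd : nat -> nat -> Omega -> 'M[R]_k) l a :
  measurable_fun setT thetainv ->
  (forall j, measurable (J @^-1` [set j])) ->
  (forall n, measurable (Nm @^-1` [set n])) ->
  (forall l n i j, measurable_fun setT (fun w => Pd l n w i j)) ->
  measurable_fun setT (fun w => qvec thetainv J Nm Pd l w a ord0).
Proof.
move=> mi mJ mN mP; elim/ltn_ind: l a => -[|l] IH a.
  by apply: (measurable_fun_index (f := fun j w => e_vec R j a ord0)).
under eq_fun do rewrite qvecS summxE.
apply: measurable_sum => i.
pose f n w := ((Pd (l.+1 - i)%N n (iter n thetainv w) *m
  qvec thetainv J Nm Pd i (iter n thetainv w)) *+ 'C(l.+1, i)) a ord0.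
apply: (measurable_fun_index (f := f)) => // n; rewrite /f.
under eq_fun do rewrite mulmxnE mxE.
under eq_fun do rewrite -mulr_natr.
apply: measurable_funM; last exact: measurable_cst.
apply: measurable_sum => b; apply: measurable_funM.
  by apply: (measurableT_comp (mP _ _ _ _)); exact: measurable_iter.
by apply: (measurableT_comp (IH i (ltn_ord i) b)); exact: measurable_iter.
Qed.

End Measurability.

(** * Uniform bounds on sets of large measure *)

Section Regularity.
Context {R : realType} (d : measure_display) (Omega : measurableType d).
Variable mu : probability Omega R.

Lemma ae_forall_countable (I : countType) (Q : I -> Omega -> Prop) :
  (forall i, {ae mu, forall w, Q i w}) -> {ae mu, forall w, forall i, Q i w}.
Proof.
move=> HQ.
have : {ae mu, forall w, forall n : nat,
    if unpickle n is Some i then Q i w else True}.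
  apply: ae_foralln => n; case: (unpickle n) => [i|]; first exact: HQ.
  exact: nearW.
by apply: filterS => w H i; have := H (pickle i); rewrite pickleK.
Qed.

Definition regular k (A : R -> Omega -> 'M[R]_k) (e : R) w : Prop :=
  [/\ (forall a b, rcts e (fun x => A x w a b)),
      (forall x, 0 <= x < e -> col_stochastic (A x w)) &
      (forall x, 0 <= x < e -> forall a b, `|A x w a b - A 0 w a b| <= x)].

(* The null sets of [markov_perturbation] depend on [eps]; continuity in [eps]
   reduces to the countably many rational values. *)
Lemma ae_regular k (A : R -> Omega -> 'M[R]_k) m : (1 <= m)%N ->
  markov_perturbation mu A -> Cm_perturbation mu A m ->
  exists2 e, 0 < e & {ae mu, forall w, regular A e w}.
Proof.
move=> m1 [Ast Anear] [e [e0 aeC]]; exists e => //.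
have aeQ : {ae mu, forall w, forall r : rat, 0 < (ratr r : R) ->
    col_stochastic (A (ratr r) w) /\ mnorm1 (A (ratr r) w - A 0 w) <= ratr r}.
  apply: ae_forall_countable => r.
  have [r0|nr0] := pselect (0 < (ratr r : R)); last by apply: nearW => w /nr0.
  have [_ H1] := Ast _ (ltW r0); have H2 := Anear _ (ltW r0).
  by apply: filterS2 H1 H2 => w.
apply: filterS2 aeC aeQ => w HC HQ.
have rc a b : rcts e (fun x => A x w a b) by exact: Cm_on_rcts m1 (HC a b).
have rcs b : rcts e (fun x => \sum_(a < k) A x w a b) by apply: rcts_sum.
split=> // x xe.
  split=> [a b|b].
    apply: (rcts_ge0_rat (f := fun x => A x w a b)) xe => // r /andP[r0 _].
    by have [[+ _] _] := HQ r r0; exact.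
  apply/eqP; rewrite eq_le -subr_ge0 -[(1 <= _)]subr_ge0; apply/andP; split.
    apply: (rcts_ge0_rat (f := fun x => 1 - \sum_(a < k) A x w a b)) xe => //.
      by apply: rctsB; [exact: rcts_cst|exact: rcs].
    by move=> r /andP[r0 _]; have [[_ ->] _] := HQ r r0; rewrite subrr.
  apply: (rcts_ge0_rat (f := fun x => \sum_(a < k) A x w a b - 1)) xe => //.
    by apply: rctsB; [exact: rcs|exact: rcts_cst].
  by move=> r /andP[r0 _]; have [[_ ->] _] := HQ r r0; rewrite subrr.
move=> a b.
have near_r (r : rat) : 0 < (ratr r : R) < e ->
    `|A (ratr r) w a b - A 0 w a b| <= ratr r.
  move=> /andP[r0 _]; have [_] := HQ r r0; apply: le_trans.
  by have := le_mnorm1 (A (ratr r) w - A 0 w) a b; rewrite !mxE.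
have rcd : rcts e (fun x => A x w a b - A 0 w a b).
  by apply: rctsB; [exact: rc|exact: rcts_cst].
rewrite ler_norml; apply/andP; split; rewrite -subr_ge0.
  apply: (rcts_ge0_rat (f := fun x => A x w a b - A 0 w a b - - x)) xe => //.
    under eq_fun do rewrite opprK.
    by apply: rctsD => //; exact: rcts_id.
  by move=> r /near_r; rewrite ler_norml => /andP[H _]; rewrite subr_ge0.
apply: (rcts_ge0_rat (f := fun x => x - (A x w a b - A 0 w a b))) xe => //.
  by apply: rctsB => //; exact: rcts_id.
by move=> r /near_r; rewrite ler_norml => /andP[_ H]; rewrite subr_ge0.
Qed.

End Regularity.

Section Exhaustion.
Context {R : realType} (d : measure_display) (Omega : measurableType d).
Variables (theta thetainv : Omega -> Omega) (k : nat).
Variables (A : R -> Omega -> 'M[R]_k) (J : Omega -> 'I_k) (Q : set Omega).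
Variables (L : nat).

Local Notation P x n w := (cocycle theta (A x) n w).
Local Notation back n w := (iter n thetainv w).

(* [Q] is the event that the [L]-th correction does not vanish; rational
   parameters keep [tame N] measurable. *)
Definition tame (N : nat) : set Omega := [set w | exists K : nat, (K <= N)%N /\
  forall r : rat, 0 < (ratr r : R) < N.+1%:R^-1 -> forall j : 'I_k,
    1 - P (ratr r) K (back K w) (J w) j <= N.+1%:R * ratr r ^+ L /\
    (Q w -> N.+1%:R^-1 * ratr r ^+ L <= 1 - P (ratr r) K (back K w) (J w) j)].

Lemma measurable_tame N :
  measurable_fun setT theta -> measurable_fun setT thetainv ->
  (forall j, measurable (J @^-1` [set j])) -> measurable Q ->
  (forall x, 0 <= x -> forall a b, measurable_fun setT (fun w => A x w a b)) ->
  measurable (tame N).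
Proof.
move=> mt mi mJ mQ mA; apply: measurable_exists => K.
apply: measurable_and_prop => _; apply: measurable_forall => r.
apply: measurable_imply_prop => /andP[r0 _]; apply: measurable_forall => j.
have mP : measurable_fun setT
    (fun w => 1 - P (ratr r) K (back K w) (J w) j).
  apply: measurable_funB; first exact: measurable_cst.
  apply: (measurable_fun_index (f := fun a w => P (ratr r) K (back K w) a j)) => // a.
  apply: (@measurableT_comp _ _ _ _ _ _ (fun w => P (ratr r) K w a j)).
    by apply: measurable_cocycle => //; apply: mA; exact: ltW.
  exact: measurable_iter.
apply: (@measurableI _ _
  [set w | 1 - P (ratr r) K (back K w) (J w) j <= N.+1%:R * ratr r ^+ L]
  [set w | Q w -> N.+1%:R^-1 * ratr r ^+ L <= 1 - P (ratr r) K (back K w) (J w) j]).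
  by apply: measurable_le => //; exact: measurable_cst.
rewrite (_ : [set w | Q w -> _] = ~` Q `|`
  [set w | N.+1%:R^-1 * ratr r ^+ L <= 1 - P (ratr r) K (back K w) (J w) j]).
  apply: measurableU; first exact: measurableC.
  by apply: measurable_le => //; exact: measurable_cst.
apply/seteqP; split=> w /=; last by case=> // nQ /nQ.
by move=> H; have [/H|] := pselect (Q w); [right|left].
Qed.

Lemma tameS N : tame N `<=` tame N.+1.
Proof.
move=> w [K [KN H]]; exists K; split=> [|r /andP[r0 rN] j]; first exact: leqW.
have [|H1 H2] := H r _ j.
  by rewrite r0 (lt_trans rN)// ltf_pV2 ?posrE// ltr_nat.
have rL : 0 <= (ratr r : R) ^+ L by rewrite exprn_ge0// ltW.
split; first by rewrite (le_trans H1)// ler_wpM2r// ler_nat.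
by move/H2; apply: le_trans; rewrite ler_wpM2r// lef_pV2 ?posrE// ler_nat.
Qed.

(** One integer dominates [K], [B], [1/c] and the inverse of the radius of validity, so a single
    increasing sequence of sets is enough. *)
Lemma tame_of_bounds w : (exists (K : nat) (B c : R), 0 < c /\
  \forall x \near (0:R)^'+, forall j,
    1 - P x K (back K w) (J w) j <= B * x ^+ L /\
    (Q w -> c * x ^+ L <= 1 - P x K (back K w) (J w) j)) ->
  exists N, tame N w.
Proof.
move=> [K [B [c [c0]]]]; rewrite near_withinE => /nbhs_ballP[e /= e0 He].
pose N := maxn (maxn K (Num.truncn B)) (maxn (Num.truncn c^-1) (Num.truncn e^-1)).
have NP (x : R) : (Num.truncn x <= N)%N -> x <= N.+1%:R.
  move=> xN; apply: (le_trans (ltW (truncnS_gt x))).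
  by rewrite ler_nat ltnS.
exists N, K; split=> [|r /andP[r0 rN] j].
  by rewrite /N !leq_max leqnn.
have re : ball (0:R) e (ratr r).
  rewrite /ball/= sub0r normrN gtr0_norm// (lt_le_trans rN)//.
  rewrite -[leRHS]invrK lef_pV2 ?posrE ?invr_gt0//.
  by apply: NP; rewrite /N !leq_max leqnn !orbT.
have [H1 H2] := He _ re r0 j.
have rL : 0 <= (ratr r : R) ^+ L by rewrite exprn_ge0// ltW.
split.
  rewrite (le_trans H1)// ler_wpM2r//.
  by apply: NP; rewrite /N !leq_max leqnn !orbT.
move/H2; apply: le_trans; rewrite ler_wpM2r//.
rewrite -[leRHS]invrK lef_pV2 ?posrE ?invr_gt0//.
by apply: NP; rewrite /N !leq_max leqnn !orbT.
Qed.

(** The cocycle is cut at time [n - K]: the first part turns [u] and [v] into other probability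
    vectors, and the window of [K] steps ending in [theta^n w] has bounds for all columns. The
    factor 2 counts the two copies. *)
Lemma tame_meet N e w n x u v : cancel theta thetainv ->
  (forall p, regular A e (iter p theta w)) ->
  (1 <= L)%N -> (N <= n)%N -> tame N (iter n theta w) ->
  0 <= x < Num.min e (2 * N.+1%:R)^-1 ->
  prob_vector u -> prob_vector v ->
  1 - x ^+ L * (2 * N.+1%:R) <= meet_prob (P x n w) u v /\
  (Q (iter n theta w) -> x ^+ L * N.+1%:R^-1 <= 1 - meet_prob (P x n w) u v).
Proof.
move=> thetaK reg L1 Nn [K [KN HK]] /andP[x0]; rewrite lt_min => /andP[xe xN].
move=> pu pv; set w' := iter n theta w in HK *.
pose p := (n - K)%N; have nE : n = (K + p)%N by rewrite subnKC// (leq_trans KN).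
have xe' : 0 <= x < e by rewrite x0.
have stoch q y : 0 <= y < e -> col_stochastic (P y q w).
  move=> ye; elim: q => [|q IH]; first exact: col_stochastic1.
  by apply: col_stochastic_mul => //; have [_ + _] := reg q; exact.
have bK : back K w' = iter p theta w.
  by rewrite /w' nE iterD iter_thetaK.
have stochK : col_stochastic (P x K (iter p theta w)).
  have : forall q, col_stochastic (P x q (iter p theta w)); last exact.
  elim=> [|q IH]; first exact: col_stochastic1.
  by apply: col_stochastic_mul => //; rewrite -iterD; have [_ + _] := reg (q + p)%N; exact.
have rcK q a b : rcts e (fun y => P y q (iter p theta w) a b).
  elim: q a b => [|q IH] a b /=; first exact: rcts_cst.
  apply: (rcts_mulmx (M := fun y => A y (iter q theta (iter p theta w)))) => //.
  by move=> c f; rewrite -iterD; have [+ _ _] := reg (q + p)%N; exact.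
have N0 : 0 < (N.+1%:R : R) by [].
have NV : (2 * N.+1%:R)^-1 <= N.+1%:R^-1 :> R.
  by rewrite lef_pV2 ?posrE ?mulr_gt0// ler_peMl// ler1n.
have bounds j : 1 - P x K (iter p theta w) (J w') j <= N.+1%:R * x ^+ L /\
    (Q w' -> N.+1%:R^-1 * x ^+ L <= 1 - P x K (iter p theta w) (J w') j).
  have xm : 0 <= x < Num.min e N.+1%:R^-1.
    by rewrite x0 lt_min xe (lt_le_trans xN).
  have me : Num.min e N.+1%:R^-1 <= e by rewrite ge_min lexx.
  have rcL c : rcts e (fun y => c * y ^+ L).
    by apply: rctsM; [exact: rcts_cst|exact: rctsX].
  have rc1 : rcts e (fun y => 1 - P y K (iter p theta w) (J w') j).
    by apply: rctsB; [exact: rcts_cst|exact: rcK].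
  split; [|move=> Qw]; rewrite -subr_ge0.
    apply: (rcts_ge0_rat (rctsB (rcL N.+1%:R) rc1) me) xm => r /andP[r0].
    rewrite lt_min => /andP[_ rN]; rewrite subr_ge0 -bK.
    by have [|] := HK r _ j; rewrite ?r0.
  apply: (rcts_ge0_rat (rctsB rc1 (rcL N.+1%:R^-1)) me) xm => r /andP[r0].
  rewrite lt_min => /andP[_ rN]; rewrite subr_ge0 -bK.
  by have [|_] := HK r _ j; [rewrite ?r0|exact].
pose u' := P x K (iter p theta w) *m (P x p w *m u).
pose v' := P x K (iter p theta w) *m (P x p w *m v).
have pu1 := prob_vector_mul (stoch p x xe') pu.
have pv1 := prob_vector_mul (stoch p x xe') pv.
have pu' : prob_vector u' by exact: prob_vector_mul.
have pv' : prob_vector v' by exact: prob_vector_mul.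
have mE : meet_prob (P x n w) u v = \sum_(i < k) u' i ord0 * v' i ord0.
  by rewrite /meet_prob nE cocycleD -!mulmxA.
have hi z : prob_vector z ->
    1 - (P x K (iter p theta w) *m z) (J w') ord0 <= N.+1%:R * x ^+ L.
  move=> pz.
  suff /andP[] : 0 <= 1 - (P x K (iter p theta w) *m z) (J w') ord0
      <= N.+1%:R * x ^+ L by [].
  apply: average_bounds => // j; rewrite subr_ge0 col_stochastic_le1//=.
  by have [] := bounds j.
rewrite mE; split.
  have := meet_lower (J w') pu' pv'; have := hi _ pu1; have := hi _ pv1.
  rewrite -/u' -/v' mulrCA -[_ * N.+1%:R]mulrC.
  by move: (\sum_(i < k) _) (_ * x ^+ L) (u' _ _) (v' _ _) => s t a b; lra.
(* The threshold [1/(2(N+1))] on [x] is made for this: with [L >= 1] it gives [(N+1) x^L <= 1/2]. *)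
move=> Qw; have vhalf : 2^-1 <= v' (J w') ord0.
  have := hi _ pv1; rewrite -/v'.
  have : N.+1%:R * x ^+ L <= 2^-1.
    rewrite -ler_pdivlMl// -invfM mulrC (le_trans _ (ltW xN))//.
    rewrite -[leRHS]expr1 ler_wiXn2l//.
    rewrite (le_trans (ltW xN))// invf_le1 ?mulr_gt0//.
    by rewrite -natrM ler1n.
  by lra.
apply: le_trans (meet_upper pu' pv' vhalf).
rewrite mulrC.
suff /andP[] : N.+1%:R^-1 * x ^+ L <= 1 - v' (J w') ord0 <= N.+1%:R * x ^+ L by [].
by apply: average_bounds => // j; have [-> /(_ Qw) ->] := bounds j.
Qed.

End Exhaustion.

(** * Splitting the times and conclusion *)

Section TimeSets.
Context {R : realType} (d : measure_display) (Omega : measurableType d).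
Variables (mu : probability Omega R) (theta thetainv : Omega -> Omega).
Hypothesis mds : invertible_mds mu theta thetainv.

Lemma ae_and (P Q : Omega -> Prop) : {ae mu, forall w, P w} ->
  {ae mu, forall w, Q w} -> {ae mu, forall w, P w /\ Q w}.
Proof. by move=> HP HQ; apply: filterS2 HP HQ. Qed.

Lemma ae_of_measure1 B : measurable B -> mu B = 1%E -> {ae mu, forall w, B w}.
Proof.
move=> mB B1; exists (~` B); split => //; first exact: measurableC.
by rewrite probability_setC// B1 subee.
Qed.

Lemma measure1_of_ae B : measurable B -> {ae mu, forall w, B w} -> mu B = 1%E.
Proof.
move=> mB aeB; have : mu (~` B) = 0%E.
  by apply: measure_negligible => //; exact: measurableC.
rewrite probability_setC// => /eqP; rewrite sube_eq ?add0e ?fin_num_measure//.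
by move/eqP.
Qed.

Lemma lowfreq_visits G : measurable G ->
  {ae mu, forall w, lowfreq [set n | G (iter n theta w)] (pr mu G)}.
Proof.
case: mds => [_ mt _ Hmu erg] mG.
have := ergodic_lower_frequency mt Hmu erg mG.
apply: filterS => w H eta eta0; have [n0 Hn0] := H _ eta0.
by exists n0 => n /Hn0.
Qed.

(* If [X] has full measure the visits to [X] fill almost all times, and even
   times are split off so that [a] stays below 1. *)
Lemma split_times X : measurable X -> 0 < pr mu X ->
  exists a : R, 0 < a < 1 /\ exists E F : Omega -> set nat,
  [/\ (forall w, E w `&` F w = set0),
      (forall w n, F w n -> X (iter n theta w)) &
      {ae mu, forall w, lowfreq (E w) a /\ lowfreq (F w) (1 - a)}].
Proof.
move=> mX X0; have mXC := measurableC mX.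
have prC : pr mu (~` X) = 1 - pr mu X by rewrite /pr probability_setC// muE.
have X1 : pr mu X <= 1 by rewrite -lee_fin -muE// probability_le1.
have [Xlt1|] := ltP (pr mu X) 1.
  exists (1 - pr mu X); split; first by apply/andP; split; lra.
  exists (fun w => [set n | (~` X) (iter n theta w)]),
    (fun w => [set n | X (iter n theta w)]); split=> //.
    by move=> w; apply/seteqP; split=> n // -[].
  have := lowfreq_visits mX; have := lowfreq_visits mXC.
  apply: filterS2 => w; rewrite prC => H1 H2; split=> //.
  by rewrite opprB addrC subrK.
move=> X1'; have {X1 X1'}XE : pr mu X = 1 by apply/eqP; rewrite eq_le X1 X1'.
exists 2^-1; split; first by apply/andP; split; lra.
exists (fun w => [set n | odd n = false]),
  (fun w => [set n | odd n = true] `&` [set n | X (iter n theta w)]); split.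
- by move=> w; apply/seteqP; split=> n // -[/= -> []].
- by move=> w n [].
- have := lowfreq_visits mX; apply: filterS => w H; split.
    exact: lowfreq_parity.
  have := lowfreqI (lowfreq_parity true) H; rewrite XE.
  by rewrite (_ : 2^-1 + 1 - 1 = 1 - 2^-1 :> R)//; lra.
Qed.

End TimeSets.

Theorem theoremC (R : realType) (d : measure_display) (Omega : measurableType d)
  (mu : probability Omega R) (theta thetainv : Omega -> Omega) (k m : nat)
  (A : R -> Omega -> 'M[R]_k) (J : Omega -> 'I_k) (Nm : Omega -> nat)
  (Pd : nat -> nat -> Omega -> 'M[R]_k) :
  (2 <= k)%N -> (1 <= m)%N ->
  invertible_mds mu theta thetainv ->
  markov_perturbation mu A ->
  is_DRN mu theta (A 0) ->
  synchronized mu theta (A 0) ->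
  Cm_perturbation mu A m ->
  sync_index_time mu theta thetainv (A 0) J Nm ->
  cocycle_derivs mu theta A m Pd ->
  (mu (Omega_deg thetainv J Nm Pd m) < 1)%E ->
  exists a : R, 0 < a < 1 /\
  exists l : nat, (1 <= l <= m)%N /\
  exists delta0 : R, 0 < delta0 /\
  forall delta : R, 0 < delta < delta0 ->
  exists epsd bd cd : R, [/\ 0 < epsd, 0 < bd & 0 < cd] /\
  exists E F : Omega -> set nat,
  {ae mu, forall w,
    [/\ E w `&` F w = set0,
        ((a - delta)%:E < limn_einf (fun n => (dens (E w) n)%:E))%E,
        ((1 - a - delta)%:E < limn_einf (fun n => (dens (F w) n)%:E))%E &
        forall eps : R, 0 <= eps < epsd ->
        forall u v : 'cV[R]_k, prob_vector u -> prob_vector v ->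
          (forall n, E w n ->
             1 - eps ^+ l * bd <= meet_prob (cocycle theta (A eps) n w) u v) /\
          (forall n, F w n ->
             eps ^+ l * cd <= 1 - meet_prob (cocycle theta (A eps) n w) u v)]}.
Proof.
move=> _ m1 mds pert _ _ Cm [mJ mN aeJ] [mPd aePd] degm.
have [[thetaK thetainvK] mt mi Hmu erg] := mds.
pose q := qvec thetainv J Nm Pd.
have mZ l : measurable [set w | q l w = 0].
  rewrite (_ : [set w | _] = [set w | forall a, q l w a ord0 = 0]).
    apply: measurable_forall => a.
    have mq : measurable_fun setT (fun w => q l w a ord0) by exact: measurable_qvec.
    have := mq measurableT [set 0]; rewrite setTI; apply; exact: measurable_set1.
  apply/seteqP; split=> w /=; first by move=> -> a; rewrite mxE.
  by move=> H; apply/matrixP => a b; rewrite (ord1 b) H mxE.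
have mdeg l : measurable (Omega_deg thetainv J Nm Pd l).
  apply: measurable_forall => i; apply: measurable_imply_prop => _; exact: mZ.
have exL : exists l, `[< (1 <= l <= m)%N /\
    (mu (Omega_deg thetainv J Nm Pd l) < 1)%E >].
  by exists m; apply/asboolP; rewrite m1 leqnn.
have [L /asboolP[L1m degL] Lmin] := ex_minnP exL.
have [L1 Lm] := andP L1m.
have ae_vanish : {ae mu, forall w, forall i, (1 <= i < L)%N -> q i w = 0}.
  have [L2|] := ltnP 1 L; last first.
    by move=> L2; apply: nearW => w i /andP[i1 iL]; have := leq_ltn_trans i1 (leq_trans iL L2).
  have : {ae mu, forall w, Omega_deg thetainv J Nm Pd L.-1 w}.
    apply: ae_of_measure1 => //; apply/eqP; rewrite eq_le probability_le1//=.
    rewrite leNgt; apply/negP => H.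
    suff : (L <= L.-1)%N by rewrite -ltnS prednK// ltnn.
    apply: Lmin; apply/asboolP; split=> //.
    by rewrite -ltnS prednK// L2 (leq_trans (leq_pred _)).
  apply: filterS => w H i /andP[i1 iL]; apply: H.
  by rewrite i1 -ltnS prednK.
pose X := [set w | q L w != 0].
have XE : X = ~` [set w | q L w = 0].
  by apply/seteqP; split=> w /= => [/eqP|/eqP].
have mX : measurable X by rewrite XE; exact: measurableC.
(* Were [X] null, all corrections up to order [L] would vanish almost everywhere, against the choice
   of [L]. *)
have X0 : 0 < pr mu X.
  rewrite lt_neqAle fine_ge0// andbT eq_sym; apply/eqP => X0.
  move: degL; rewrite measure1_of_ae ?ltxx//.
  have aeX : {ae mu, forall w, ~ X w}.
    exists X; split => //; first by rewrite muE// X0.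
    by move=> w /= /contrapT.
  apply: filterS2 aeX ae_vanish => w nX van i /andP[i1 iL].
  have [->|iL'] := eqVneq i L; first by apply: contrapT => /eqP.
  by apply: van; rewrite i1 ltn_neqAle iL'.
have [a [a01 [E' [F' [EF FX aeEF]]]]] := split_times mds mX X0.
exists a; split=> //; exists L; split=> //; exists 1; split=> // delta /andP[delta0 _].
have [e e0 aereg] := ae_regular m1 pert Cm.
have aeAll : {ae mu, forall w, [/\ regular A e w,
    (forall n, cocycle theta (A 0) n w *m e_vec R (J w) = e_vec R (J (iter n theta w))) /\
    (forall n j, (Nm w <= n)%N ->
      cocycle theta (A 0) n (iter n thetainv w) *m e_vec R j = e_vec R (J w)),
    (forall l n i j, (l <= m)%N ->
      rderiv0 (fun eps => cocycle theta (A eps) n w i j) l (Pd l n w i j)) &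
    (forall i, (1 <= i < L)%N -> q i w = 0)]}.
  have := ae_and (ae_and aereg ae_vanish) (ae_and aeJ aePd).
  by apply: filterS => w [[? ?] [? ?]].
have [Good [aeG GQ Gt Gi]] := ae_orbit mds aeAll.
have bounds w : Good w -> exists N, tame theta thetainv A J X L N w.
  move=> Gw; apply: tame_of_bounds.
  apply: (two_sided_bounds (m := m) (e0 := e) (Good := Good)) => //.
  - by move=> w1 /GQ[[]].
  - by move=> w1 /GQ[[]].
  - by move=> w1 /GQ[_ []].
  - by move=> w1 /GQ[_ [_ H]] _ _ n j; exact: H.
  - by move=> w1 /GQ[].
  - by move=> w1 /GQ[].
have mtame N : measurable (tame theta thetainv A J X L N).
  apply: measurable_tame => // x x0 b c.
  by have [/(_ x x0)[+ _] _] := pert; exact.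
have [N HN] : exists N, (mu (~` tame theta thetainv A J X L N) < delta%:E)%E.
  apply: exhaustion => //; first exact: tameS.
  by apply: filterS aeG => w; exact: bounds.
pose T := tame theta thetainv A J X L N.
have prT : 1 - delta < pr mu T.
  move: HN; rewrite probability_setC// muE// -EFinB lte_fin -/T; lra.
(* [N <= n] keeps the window of [K <= N] steps inside nonnegative times. As [T] has measure above
   [1 - delta], intersecting with [late] costs less than [delta] in frequency. *)
pose late w := [set n | (N <= n)%N] `&` [set n | T (iter n theta w)].
exists (Num.min e (2 * N.+1%:R)^-1), (2 * N.+1%:R), N.+1%:R^-1; split.
  by split=> //; rewrite lt_min e0 invr_gt0 mulr_gt0.
(* Meeting is likely at every [late] time; [E'] serves to keep these times disjoint from those of
   [F'], which lie in the visits to [X]. *)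
exists (fun w => E' w `&` late w), (fun w => F' w `&` late w).
have := ae_and aeG (ae_and aeEF (lowfreq_visits mds (mtame N))).
apply: filterS => w [Gw [[HE HF] HT]].
have Glate := lowfreqI (lowfreq_geq N) HT.
split.
- apply/seteqP; split=> n // -[[En _] [Fn _]].
  by have := EF w; rewrite -subset0; apply; split; [exact: En|exact: Fn].
- by apply: lowfreq_limn_einf (lowfreqI HE Glate) _; move: prT; rewrite /T; lra.
- by apply: lowfreq_limn_einf (lowfreqI HF Glate) _; move: prT; rewrite /T; lra.
move=> eps epsr u v pu pv.
have reg p : regular A e (iter p theta w).
  suff /GQ[] : Good (iter p theta w) by [].
  by elim: p => //= p; exact: Gt.
split=> n [En [Nn Tn]].
  by have [] := tame_meet thetaK reg L1 Nn Tn epsr pu pv.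
have [_] := tame_meet thetaK reg L1 Nn Tn epsr pu pv.
by apply; exact: FX En.
Qed.
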